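(* Fix $r\in(0,\infty)$ and $\beta>0$. Let $(s_n)$ be a sequence of integers with $1\le s_n\le n$, $\eta_n=s_n/n\to0$ as $n\to\infty$, and let $t_n>0$ satisfy $\log t_n=\beta\log\eta_n^{-1}$. For $l>0$ let $\hat p_S[l]$ be the Bayes predictive density estimate based on the product spike-and-slab prior $\prod_{i=1}^n\pi_{\mathsf S}[\eta_n,l](d\theta_i)$. Then, as $n\to\infty$, $$\min_{l>1}\ \max_{\boldsymbol\theta\in\Theta_n[s_n,t_n]}\rho(\boldsymbol\theta,\hat p_S[l])\ \ge\ (1+\beta)\,R_N(\Theta_n[s_n,t_n])\,(1+o(1)).$$
   Context: Model: $\boldsymbol X\sim N_n(\boldsymbol\theta,\boldsymbol I)$ and $\boldsymbol Y\sim N_n(\boldsymbol\theta,r\boldsymbol I)$ are independent given the unknown $\boldsymbol\theta\in\mathbb R^n$; $r>0$ is known and fixed. Let $p(\boldsymbol x|\boldsymbol\theta,1)$ and $p(\boldsymbol y|\boldsymbol\theta,r)$ denote the Gaussian densities of $\boldsymbol X$ and $\boldsymbol Y$. A predictive density estimator $\hat p(\boldsymbol y|\boldsymbol x)$ is, for each $\boldsymbol x\in\mathbb R^n$, a probability density in $\boldsymbol y\in\mathbb R^n$ (jointly measurable). Its Kullback–Leibler loss is $L(\boldsymbol\theta,\hat p(\cdot|\boldsymbol x))=\int p(\boldsymbol y|\boldsymbol\theta,r)\log\frac{p(\boldsymbol y|\boldsymbol\theta,r)}{\hat p(\boldsymbol y|\boldsymbol x)}\,d\boldsymbol y$ and its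 risk is $\rho(\boldsymbol\theta,\hat p)=\int L(\boldsymbol\theta,\hat p(\cdot|\boldsymbol x))\,p(\boldsymbol x|\boldsymbol\theta,1)\,d\boldsymbol x$. For a prior $\pi$ on $\mathbb R^n$ the Bayes predictive density estimate is $\hat p_\pi(\boldsymbol y|\boldsymbol x)=\int p(\boldsymbol y|\boldsymbol\theta,r)\,\pi(d\boldsymbol\theta|\boldsymbol x)$, with $\pi(d\boldsymbol\theta|\boldsymbol x)$ the posterior given $\boldsymbol X=\boldsymbol x$. Let $\|\boldsymbol\theta\|_0=\#\{i:\theta_i\ne0\}$, $\Theta_n[s,t]=\{\boldsymbol\theta\in\mathbb R^n:\|\boldsymbol\theta\|_0\le s\text{ and }|\theta_i|\le t\text{ for all }i=1,\dots,n\}$, and $R_N(\Theta)=\inf_{\hat p}\sup_{\boldsymbol\theta\in\Theta}\rho(\boldsymbol\theta,\hat p)$, the infimum being over all predictive density estimators. ''$\max$'' and ''$\min$'' denote supremum and infimum. Spike-and-slab prior: $\pi_{\mathsf S}[\eta,l](d\mu)=(1-\eta)\delta_0(d\mu)+\frac{\eta}{2l}\,\mathbf 1\{\mu\in[-l,l]\}\,d\mu$ for $l>0$, where $\delta_0$ is the unit point mass at $0$. *)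

(* Defs.v *)
From HB Require Import structures.
From mathcomp Require Import all_boot all_order all_algebra.
From mathcomp Require Import all_classical all_reals all_analysis.
From mathcomp Require Import measurable_realfun.

Set Implicit Arguments.
Unset Strict Implicit.
Unset Printing Implicit Defensive.

Import Order.TTheory GRing.Theory Num.Theory.
Import numFieldNormedType.Exports.

Local Open Scope classical_set_scope.
Local Open Scope ring_scope.

Definition cons_pair (T : Type) n (p : T * n.-tuple T) : n.+1.-tuple T :=
  [tuple of p.1 :: p.2].

(* The n-fold product measure mu (x) ... (x) mu, as a measure on n.-tuple T
   through the identification of T * n.-tuple T with n.+1.-tuple T. *)
Fixpoint tensor_power d (T : measurableType d) (R : realType)
    (mu : set T -> \bar R) (n : nat) : set (n.-tuple T) -> \bar R :=
  match n with
  | 0%N => @dirac _ (0.-tuple T) [tuple] R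
  | k.+1 => pushforward (mu \x @tensor_power d T R mu k)%E (@cons_pair T k)
  end.
Arguments tensor_power {d T R} mu n : simpl never.

Section tensor_power_measure.
Local Open Scope ereal_scope.
Context d (T : measurableType d) (R : realType).

Lemma measurable_cons_pair n :
  measurable_fun [set: T * n.-tuple T] (@cons_pair T n).
Proof. exact: measurable_cons. Qed.

Let is_sigma_finite_measure d' (T' : measurableType d')
    (m : set T' -> \bar R) :=
  [/\ m set0 = 0, forall A, 0 <= m A, semi_sigma_additive m &
      sigma_finite setT m].

Let product_sigma_finite d' (T' : measurableType d')
    (mu : {sigma_finite_measure set T -> \bar R})
    (nu : {sigma_finite_measure set T' -> \bar R}) :
  sigma_finite setT (mu \x nu).
Proof.
have /sigma_finiteP[F [TF ndF Foo]] := sigma_finiteT mu.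
have /sigma_finiteP[G [TG ndG Goo]] := sigma_finiteT nu.
exists (fun k => F k `*` G k).
  rewrite -setXTT TF TG predeqE => -[x y]; split.
    move=> [/= [n _ Fnx] [k _ Gky]]; exists (maxn n k) => //; split.
    - by move: x Fnx; exact/subsetPset/ndF/leq_maxl.
    - by move: y Gky; exact/subsetPset/ndG/leq_maxr.
  by move=> [n _ []/= ? ?]; split; exists n.
move=> k; have [? ?] := Foo k; have [? ?] := Goo k.
split; first exact: measurableX.
by rewrite product_measure1E// lte_mul_pinfty// ge0_fin_numE.
Qed.

Let pushforward_cons_pair (mu : {sigma_finite_measure set T -> \bar R}) n
    (nu : {sigma_finite_measure set (n.-tuple T) -> \bar R}) :
  is_sigma_finite_measure (pushforward (mu \x nu) (@cons_pair T n)).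
Proof.
have mc := @measurable_cons_pair n.
split.
- exact: measure0.
- exact: measure_ge0.
- exact: measure_semi_sigma_additive.
have [F FT mF] : sigma_finite setT (mu \x nu) by exact: product_sigma_finite.
pose uncons (t : n.+1.-tuple T) := (thead t, [tuple of behead t]).
have muncons : measurable_fun setT uncons.
  apply/measurable_fun_pairP; split; last exact: measurable_behead.
  exact: measurable_tnth.
exists (fun k => uncons @^-1` F k).
  by rewrite -preimage_bigcup -FT preimage_setT.
move=> k; have [mFk Fk] := mF k; split.
  by rewrite -[X in measurable X]setTI; exact: muncons.
rewrite /pushforward -comp_preimage (_ : uncons \o _ = id)//.
apply/funext => -[x t]; rewrite /uncons/= /cons_pair theadE.
by congr pair; exact: val_inj.
Qed.

Let tensor_powerP (mu : {sigma_finite_measure set T -> \bar R}) n :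
  is_sigma_finite_measure (tensor_power mu n).
Proof.
elim: n => [|n [nu0 nu_ge0 nu_sadd nu_sfin]].
  split; [exact: measure0|exact: measure_ge0|exact: measure_semi_sigma_additive|].
  exact: (@sigma_finiteT _ _ _ (@dirac _ (0.-tuple T) [tuple] R)).
pose nuM := isMeasure.Build _ _ _ (tensor_power mu n) nu0 nu_ge0 nu_sadd.
pose nu1 : {measure set (n.-tuple T) -> \bar R} :=
  HB.pack (tensor_power mu n) nuM.
pose nuS := Measure_isSigmaFinite.Build _ _ _ (Measure.sort nu1) nu_sfin.
pose nu : {sigma_finite_measure set (n.-tuple T) -> \bar R} :=
  HB.pack (Measure.sort nu1) nuS.
exact: (pushforward_cons_pair mu nu).
Qed.

Section instances.
Variables (mu : {sigma_finite_measure set T -> \bar R}) (n : nat).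

Let tp0 : tensor_power mu n set0 = 0.
Proof. by case: (tensor_powerP mu n). Qed.

Let tp_ge0 A : 0 <= tensor_power mu n A.
Proof. by case: (tensor_powerP mu n). Qed.

Let tp_sigma_additive : semi_sigma_additive (tensor_power mu n).
Proof. by case: (tensor_powerP mu n). Qed.

HB.instance Definition _ := isMeasure.Build _ _ _ (tensor_power mu n)
  tp0 tp_ge0 tp_sigma_additive.

Let tp_sigma_finite : sigma_finite setT (tensor_power mu n).
Proof. by case: (tensor_powerP mu n). Qed.

HB.instance Definition _ := Measure_isSigmaFinite.Build _ _ _
  (tensor_power mu n) tp_sigma_finite.

End instances.

Lemma tensor_power_rect (mu : {sigma_finite_measure set T -> \bar R}) n
    (A : 'I_n -> set T) : (forall i, measurable (A i)) ->
  tensor_power mu n [set x | forall i, A i (tnth x i)] =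
  \prod_(i < n) mu (A i).
Proof.
elim: n A => [|n IH] A mA.
  rewrite big_ord0 /tensor_power /dirac indicE mem_set//.
  by case.
rewrite big_ord_recl -IH//.
rewrite (_ : tensor_power mu n.+1 =
  pushforward (mu \x tensor_power mu n) (@cons_pair T n))//.
rewrite -product_measure1E//; last first.
  rewrite (_ : mkset _ = \bigcap_(i in [set: 'I_n])
      ((fun x : n.-tuple T => tnth x i) @^-1` A (lift ord0 i))).
    apply: fin_bigcap_measurable => // i _.
    by rewrite -[X in measurable X]setTI; exact: measurable_tnth.
  by apply/seteqP; split => x /= h i; [move=> _|]; exact: h.
rewrite /pushforward; congr product_measure1.
apply/seteqP; split => -[x t] /=.
  move=> h; split => [|i]; first by have := h ord0; rewrite tnth0.
  by have := h (lift ord0 i); rewrite tnthS.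
move=> [Ax At] i; case: (unliftP ord0 i) => [j ->|->].
  by rewrite /cons_pair tnthS; exact: At.
by rewrite /cons_pair tnth0.
Qed.

Section probability.
Variables (P : probability T R) (n : nat).

Let tp1 : tensor_power P n setT = 1.
Proof.
rewrite (_ : setT = [set x : n.-tuple T | forall i, setT (tnth x i)]).
  rewrite (@tensor_power_rect P n (fun=> setT))// big1// => i _.
  exact: probability_setT.
by apply/seteqP; split.
Qed.

HB.instance Definition _ := Measure_isProbability.Build _ _ _
  (tensor_power P n) tp1.

End probability.
End tensor_power_measure.

(* R^n with its Borel sigma-algebra, which is the one generated by the
   coordinates; measurableTypeR R is the real line R *)
Notation Rn R n := (n.-tuple (measurableTypeR R)).

Section gaussian_prediction.
Context (R : realType) (n : nat).
Implicit Types (theta x y : Rn R n) (v r : R).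

Definition lebesgue_n : set (Rn R n) -> \bar R :=
  tensor_power (@lebesgue_measure R) n.

HB.instance Definition _ := SigmaFiniteMeasure.on lebesgue_n.

(* density at x of N_n(theta, v I); normal_pdf is parametrized by the standard
   deviation *)
Definition gauss_pdf theta v x : R :=
  \prod_(i < n) normal_pdf (tnth theta i) (Num.sqrt v) (tnth x i).

Lemma gauss_pdf_ge0 theta v x : 0 <= gauss_pdf theta v x.
Proof. by apply: prodr_ge0 => i _; exact: normal_pdf_ge0. Qed.

Lemma measurable_gauss_pdf_mean v x : 0 < v ->
  measurable_fun setT (fun theta => gauss_pdf theta v x).
Proof.
move=> v0; rewrite /gauss_pdf.
rewrite [X in measurable_fun _ X](_ : _ = fun theta : Rn R n =>
    \prod_(i < n) normal_pdf (tnth x i) (Num.sqrt v) (tnth theta i)).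
  apply: measurable_prod => i _.
  apply: measurableT_comp; first exact: measurable_normal_pdf.
  exact: measurable_tnth.
apply/funext => theta; apply: eq_bigr => i _.
by rewrite !normal_pdfE ?gt_eqF ?sqrtr_gt0// /normal_fun -sqrrN opprB.
Qed.

(* phat x y stands for the estimated density of Y = y given X = x *)
Definition predictive_density (phat : Rn R n -> Rn R n -> R) : Prop :=
  [/\ measurable_fun [set: Rn R n * Rn R n] (fun xy => phat xy.1 xy.2),
      forall x y, 0 <= phat x y &
      forall x, (\int[lebesgue_n]_y (phat x y)%:E = 1)%E].

(* The logarithm is taken in \bar R, where p / 0 = +oo for p > 0 and
   lne +oo = +oo: an estimate vanishing on a non-null set has infinite loss. *)
Definition KL_loss r theta (q : Rn R n -> R) : \bar R :=
  (\int[lebesgue_n]_y ((gauss_pdf theta r y)%:E *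
     lne ((gauss_pdf theta r y)%:E / (q y)%:E)))%E.

Definition risk r theta (phat : Rn R n -> Rn R n -> R) : \bar R :=
  (\int[lebesgue_n]_x (KL_loss r theta (phat x) * (gauss_pdf theta 1 x)%:E))%E.

Definition max_risk r (Theta : set (Rn R n)) (phat : Rn R n -> Rn R n -> R) :
    \bar R :=
  ereal_sup [set risk r theta phat | theta in Theta].

Definition minimax_risk r (Theta : set (Rn R n)) : \bar R :=
  ereal_inf [set max_risk r Theta phat | phat in predictive_density].

Definition l0norm theta : nat := #|[pred i | tnth theta i != 0]|.

Definition sparse_box (s : nat) (t : R) : set (Rn R n) :=
  [set theta | (l0norm theta <= s)%N /\ forall i, `|tnth theta i| <= t].

Section posterior.
Variables (prior : probability (Rn R n) R) (x : Rn R n).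

Definition unnormalized_posterior (A : set (Rn R n)) : \bar R :=
  (\int[prior]_(theta in A) (gauss_pdf theta 1 x)%:E)%E.

Let up0 : unnormalized_posterior set0 = 0%E.
Proof. exact: integral_set0. Qed.

Let up_ge0 A : (0 <= unnormalized_posterior A)%E.
Proof. by apply: integral_ge0 => theta _; rewrite lee_fin gauss_pdf_ge0. Qed.

Let up_sigma_additive : semi_sigma_additive unnormalized_posterior.
Proof.
move=> F mF tF mUF; rewrite /unnormalized_posterior; apply: cvg_toP.
  apply: ereal_nondecreasing_is_cvgn => i j ij.
  by apply: lee_sum_nneg_natr => // k _ _; exact: up_ge0.
rewrite ge0_integral_bigcup//.
- apply: measurable_funTS; apply/measurable_EFinP.
  exact: measurable_gauss_pdf_mean.
- by move=> theta _; rewrite lee_fin gauss_pdf_ge0.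
Qed.

HB.instance Definition _ := isMeasure.Build _ _ _ unnormalized_posterior
  up0 up_ge0 up_sigma_additive.

(* The second argument of mnormalize is its value when the total mass is 0 or
   +oo; this never happens here since the Gaussian density is positive and
   bounded. *)
Definition posterior : set (Rn R n) -> \bar R :=
  mnormalize unnormalized_posterior prior.

HB.instance Definition _ := Probability.on posterior.

End posterior.

Definition bayes_predictive r (prior : probability (Rn R n) R) x y : R :=
  \int[posterior prior x]_theta gauss_pdf theta r y.

End gaussian_prediction.
Arguments sparse_box {R} n s t.

Section spike_and_slab.
Context (R : realType) (eta : {i01 R}) (l : {posnum R}).

Lemma slab_lt : - l%:num < l%:num.
Proof. by rewrite gtrN. Qed.

(* the slab eta / (2 l) 1_[-l, l] dmu is eta times the uniform law on [-l, l] *)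
Definition spike_slab : set (measurableTypeR R) -> \bar R :=
  measure_add (mscale (1 - eta%:num)%:nng (@dirac _ (measurableTypeR R) 0 R))
              (mscale eta%:num%:nng (uniform_prob slab_lt)).

HB.instance Definition _ := Measure.on spike_slab.

Let spike_slab1 : spike_slab setT = 1%E.
Proof.
rewrite /spike_slab measure_addE /mscale/= [X in (_ * X + _)%E]diracT.
rewrite [X in (_ + _ * X)%E]probability_setT !mule1.
by rewrite -EFinD subrK.
Qed.

HB.instance Definition _ := Measure_isProbability.Build _ _ _
  spike_slab spike_slab1.

End spike_and_slab.

Definition spike_slab_predictive (R : realType) (n : nat) (r : R)
    (eta : {i01 R}) (l : {posnum R}) : Rn R n -> Rn R n -> R :=
  bayes_predictive r (tensor_power (spike_slab eta l) n).
Arguments spike_slab_predictive {R} n r eta l.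

(* Main.v *)
(* Let [v = r / (1 + r)] and [L = ln (1 / eta)], so that [ln (t / eta) = (1 + beta) L].

   Upper bound on the minimax risk.  Predict each coordinate by the mixture of N(0, r)
   and N(x, r) whose odds for the second component are about [eta e^(x^2/2)].  At a
   null coordinate the expected odds bound the risk, by [O(eta sqrt L)].  At a signal
   mu, the first component gives a loss of about [mu^2 / (2 r)] and the second one
   about [(L - mu^2 / 2)_+], whose minimum is at most [L / (1 + r)]; all errors are
   quadratic in the Gaussian noise, with coefficients [O(sqrt L)].  Hence the minimax
   risk is at most [s (L / (1 + r) + O(sqrt L))].

   Lower bound for the spike-and-slab predictive density.  It is the ratio of the
   marginal density of (x, y) by that of x, the latter being at least [1 - eta] times
   the density under the spike.  If [l >= t / (4 (1 + r))], the slab has density at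
   most [O(e^(- (1 + beta) L))]: at the signal [mu^2 = 2 v (1 + beta) L <= t^2], the
   spike and the slab contribute at most [e^(- (1 + beta) L)] each to the marginal of
   (x, y), up to factors [e^(O(sqrt L))] and noise, and the loss is at least
   [(1 + beta) L - mu^2 / 2 - O(sqrt L) = (1 + beta) L / (1 + r) - O(sqrt L)].
   If [l < t / (4 (1 + r))], the signal [mu = t] is out of reach of the slab and costs at
   least [t^2 / (4 r) - O(t)], which is polynomial in [1 / eta].  At the null
   coordinates, [ln u <= u - 1] loses at most [2 eta] each, hence [2 s] in total. *)
Require Import Defs.
From mathcomp Require Import all_boot all_order all_algebra.
From mathcomp Require Import all_classical all_reals all_analysis.
From mathcomp Require Import measurable_realfun ring lra.

Import Order.TTheory GRing.Theory Num.Theory.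
Import numFieldNormedType.Exports.

Local Open Scope classical_set_scope.
Local Open Scope ring_scope.

(** * Integrals with respect to product measures *)

Section integral_tools.
Local Open Scope ereal_scope.
Import HBNNSimple.

(* Unlike [le_integral], no measurability or integrability is needed, since
   the integral is a difference of two suprema over simple functions. *)
Lemma le_integral_pointwise d (T : measurableType d) (R : realType)
    (mu : {measure set T -> \bar R}) (f g : T -> \bar R) :
  (forall x, f x <= g x) -> \int[mu]_x f x <= \int[mu]_x g x.
Proof.
move=> fg.
have le_nn (h k : T -> \bar R) : (forall x, 0 <= h x) -> (forall x, h x <= k x) ->
    \int[mu]_x h x <= \int[mu]_x k x.
  move=> h0 hk; rewrite !ge0_integralTE//; last first.
    by move=> x; exact: le_trans (hk x).
  apply: ereal_sup_le => _ [s sh <-]; exists s => // x.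
  exact: le_trans (sh x) (hk x).
rewrite integralE [leRHS]integralE; apply: leeB; apply: le_nn => x.
- exact: funepos_ge0.
- by rewrite !funeposE ge_max !le_max fg lexx !orbT.
- exact: funeneg_ge0.
- by rewrite !funenegE ge_max !le_max leeN2 fg lexx !orbT.
Qed.

(** Simple functions increasing to [f] reduce the claim to indicators, where it is the hypothesis on
    [nu]. It serves to integrate against the posterior, which has a density with respect to the
    prior. *)
Lemma integral_with_density d (T : measurableType d) (R : realType)
    (mu nu : {measure set T -> \bar R}) (g : T -> R) (f : T -> \bar R) :
  measurable_fun setT g -> (forall x, (0 <= g x)%R) ->
  (forall A, measurable A -> nu A = \int[mu]_(x in A) (g x)%:E) ->
  measurable_fun setT f -> (forall x, 0 <= f x) ->
  \int[nu]_x f x = \int[mu]_x (f x * (g x)%:E).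
Proof.
move=> mg g0 nuE mf f0.
have mgE : measurable_fun setT (EFin \o g) by exact/measurable_EFinP.
pose f_ := nnsfun_approx measurableT mf.
have fcvg x : (f_ n x)%:E @[n --> \oo] --> f x by exact: cvg_nnsfun_approx.
have fnd x : {homo (fun n => (f_ n x)%:E) : m n / (m <= n)%N >-> m <= n}.
  by move=> m n mn; rewrite lee_fin; exact/lefP/nd_nnsfun_approx.
have mfg (h : {nnsfun T >-> R}) : measurable_fun setT (fun x => (h x)%:E * (g x)%:E).
  by apply: emeasurable_funM => //; exact/measurable_EFinP.
transitivity (limn (fun n => \int[nu]_x (f_ n x)%:E)).
  rewrite -monotone_convergence//.
  - by apply: eq_integral => x _; apply/esym/cvg_lim => //; exact: fcvg.
  - by move=> n; exact/measurable_EFinP.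
  - by move=> n x _; rewrite lee_fin.
transitivity (limn (fun n => \int[mu]_x ((f_ n x)%:E * (g x)%:E))); last first.
  rewrite -monotone_convergence//.
  - apply: eq_integral => x _; apply/cvg_lim => //.
    by apply: cvgeZr => //; exact: fcvg.
  - by move=> n x _; rewrite mule_ge0// lee_fin.
  - by move=> x _ m n mn; rewrite lee_wpmul2r ?lee_fin//; exact: fnd.
congr (limn _); apply/funext => n.
move: (f_ n) => h.
under eq_integral do rewrite fimfunE -fsumEFin//.
rewrite ge0_integral_fsum//; last 2 first.
- by move=> r; exact/measurable_EFinP/measurableT_comp.
- by move=> r x _; rewrite EFinM nnfun_muleindic_ge0.
under [RHS]eq_integral.
  move=> x _; rewrite fimfunE -fsumEFin// ge0_mule_fsuml; last first.
    by move=> r; rewrite EFinM nnfun_muleindic_ge0.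
  over.
rewrite [RHS]ge0_integral_fsum//; last 2 first.
- move=> r; apply: emeasurable_funM => //.
  by apply/measurable_EFinP/measurableT_comp.
- by move=> r x _; apply: mule_ge0; rewrite ?lee_fin// -lee_fin EFinM nnfun_muleindic_ge0.
apply: eq_fsbigr => r; rewrite inE => -[y _ hy].
have r0 : (0 <= r)%R by rewrite -hy.
under eq_integral do rewrite EFinM.
under [RHS]eq_integral do rewrite EFinM -muleA.
have mI : measurable_fun setT (fun x : T => (\1_(h @^-1` [set r]) x)%:E : \bar R).
  exact/measurable_EFinP/measurable_indic.
rewrite ge0_integralZl//.
rewrite [RHS]ge0_integralZl//; last 2 first.
- exact: emeasurable_funM.
- by move=> x _; rewrite mule_ge0 ?lee_fin.
congr (_ * _); rewrite integral_indic// setIT nuE// integral_mkcond.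
apply: eq_integral => x _; rewrite patchE indicE.
by case: ifPn => _; rewrite ?mul1e ?mul0e.
Qed.

End integral_tools.

Section tensor_integral.
Context d (T : measurableType d) (R : realType).
Variable mu : {sigma_finite_measure set T -> \bar R}.
Local Open Scope ereal_scope.

(** Tonelli's theorem splits off the first coordinate; induction does the rest. *)
Lemma integral_tensor_power_prod n (f : 'I_n -> T -> R) :
  (forall i, measurable_fun setT (f i)) -> (forall i x, (0 <= f i x)%R) ->
  \int[tensor_power mu n]_x (\prod_(i < n) f i (tnth x i))%R%:E =
  \prod_(i < n) \int[mu]_x (f i x)%:E.
Proof.
have mprod m (h : 'I_m -> T -> R) : (forall i, measurable_fun setT (h i)) ->
    measurable_fun setT (fun x : m.-tuple T => (\prod_(i < m) h i (tnth x i))%R%:E).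
  move=> mh; apply/measurable_EFinP; apply: measurable_prod => i _.
  by apply: measurableT_comp => //; exact: measurable_tnth.
elim: n f => [|n IH] f mf f0.
  rewrite big_ord0 (_ : tensor_power mu 0 = @dirac _ (0.-tuple T) [tuple] R)//.
  rewrite integral_dirac//; last exact: mprod.
  by rewrite big_ord0 diracT mul1e.
rewrite (_ : tensor_power mu n.+1 =
  pushforward (mu \x tensor_power mu n) (@cons_pair T n))//.
rewrite ge0_integral_pushforward//=; [|exact: measurable_cons_pair|exact: mprod|]; last first.
  by move=> x _; rewrite lee_fin prodr_ge0.
rewrite preimage_setT fubini_tonelli1//=; last 2 first.
- exact: (measurableT_comp (mprod n.+1 f mf) (@measurable_cons_pair d T n)).
- by move=> x; rewrite lee_fin prodr_ge0.
rewrite big_ord_recl -IH//.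
have m0 : measurable_fun setT (fun x => (f ord0 x)%:E) by exact/measurable_EFinP.
pose f' i := f (lift ord0 i).
transitivity (\int[mu]_x ((f ord0 x)%:E *
    \int[tensor_power mu n]_t (\prod_(i < n) f' i (tnth t i))%R%:E)).
  apply: eq_integral => x _; rewrite /fubini_F -ge0_integralZl//.
  - apply: eq_integral => t _; rewrite big_ord_recl /cons_pair tnth0 EFinM.
    by congr (_ * (_)%:E); apply: eq_bigr => i _; rewrite tnthS.
  - by apply: mprod => i; exact: mf.
  - by move=> t _; rewrite lee_fin prodr_ge0// => i _; exact: f0.
  - by rewrite lee_fin.
rewrite ge0_integralZr//.
- by move=> x _; rewrite lee_fin.
- by apply: integral_ge0 => t _; rewrite lee_fin prodr_ge0// => i _; exact: f0.
Qed.

Section densities.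
Context n (p f : 'I_n -> T -> R).
Hypothesis mp : forall i, measurable_fun setT (p i).
Hypothesis p0 : forall i x, (0 <= p i x)%R.
Hypothesis p1 : forall i, \int[mu]_x (p i x)%:E = 1.
Hypothesis mf : forall i, measurable_fun setT (f i).
Hypothesis f0 : forall i x, (0 <= f i x)%R.

Let measurable_coord (i : 'I_n) (h : T -> R) : measurable_fun setT h ->
  measurable_fun setT (fun x : n.-tuple T => h (tnth x i)).
Proof. by move=> mh; apply: measurableT_comp => //; exact: measurable_tnth. Qed.

Let mprod : measurable_fun setT (fun x : n.-tuple T => \prod_(j < n) p j (tnth x j))%R.
Proof. by apply: measurable_prod => j _; exact: measurable_coord. Qed.

Lemma integral_tensor_power_sum :
  \int[tensor_power mu n]_x
    ((\sum_(i < n) f i (tnth x i)) * \prod_(j < n) p j (tnth x j))%R%:E =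
  \sum_(i < n) \int[mu]_x (f i x * p i x)%:E.
Proof.
under eq_integral do rewrite big_distrl/= -sumEFin.
rewrite ge0_integral_sum//=; last 2 first.
- move=> i; apply/measurable_EFinP/measurable_funM => //; exact: measurable_coord.
- by move=> i x _; rewrite lee_fin mulr_ge0// prodr_ge0.
apply: eq_bigr => i _.
(* In the term [i], the factor [f i] joins the [i]-th density; every other density integrates to
   1. *)
pose g j x := (if j == i then f i x * p i x else p j x)%R.
transitivity (\int[tensor_power mu n]_x (\prod_(j < n) g j (tnth x j))%R%:E).
  apply: eq_integral => x _; rewrite (bigD1 i)//= [in RHS](bigD1 i)//= /g eqxx mulrA.
  by congr (_ * _)%:E; apply: eq_bigr => j /negbTE ->.
rewrite integral_tensor_power_prod.
- rewrite (bigD1 i)//= /g eqxx big1 ?mule1// => j /negbTE ->.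
  exact: p1.
- by move=> j; rewrite /g; case: eqP => // _; exact: measurable_funM.
- by move=> j x; rewrite /g; case: eqP => // _; exact: mulr_ge0.
Qed.

(** The integrand may change sign, so the integral is split through integrability, which the finite
    bounds [S] provide. This is the shape of the lower bounds on log-likelihood ratios: a constant
    minus nonnegative errors, each in a single coordinate. *)
Lemma integral_tensor_power_csum (c : R) (S : 'I_n -> R) :
  (forall i, \int[mu]_x (f i x * p i x)%:E <= (S i)%:E) ->
  (c - \sum_(i < n) S i)%R%:E <= \int[tensor_power mu n]_x
    ((c - \sum_(i < n) f i (tnth x i)) * \prod_(j < n) p j (tnth x j))%R%:E.
Proof.
move=> fS.
have sumS : \int[tensor_power mu n]_x
    ((\sum_(i < n) f i (tnth x i)) * \prod_(j < n) p j (tnth x j))%R%:E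
    <= (\sum_(i < n) S i)%R%:E.
  by rewrite integral_tensor_power_sum -sumEFin; apply: lee_sum => i _.
have int1 : \int[tensor_power mu n]_x (\prod_(j < n) p j (tnth x j))%R%:E = 1.
  by rewrite integral_tensor_power_prod// big1.
have ip : (tensor_power mu n).-integrable setT
    (fun x => (\prod_(j < n) p j (tnth x j))%R%:E).
  apply/integrableP; split; first exact/measurable_EFinP.
  under eq_integral do rewrite gee0_abs ?lee_fin ?prodr_ge0//.
  by rewrite int1 ltry.
have isum : (tensor_power mu n).-integrable setT
    (fun x => ((\sum_(i < n) f i (tnth x i)) * \prod_(j < n) p j (tnth x j))%R%:E).
  apply/integrableP; split.
    apply/measurable_EFinP/measurable_funM => //.
    by apply: measurable_sum => i; exact: measurable_coord.
  under eq_integral do rewrite gee0_abs ?lee_fin ?mulr_ge0 ?prodr_ge0 ?sumr_ge0//.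
  by apply: le_lt_trans sumS _; rewrite ltry.
under eq_integral do rewrite mulrBl EFinB EFinM.
rewrite integralB//=; last exact: integrableZl.
by rewrite integralZl// int1 mule1 EFinB leeB.
Qed.

End densities.
End tensor_integral.

(** * Gaussian densities *)

Section gaussian_density.
Context (R : realType).
Implicit Types (v m x y c : R).

Definition phi v m x : R := normal_pdf m (Num.sqrt v) x.
Definition peak v : R := normal_peak (Num.sqrt v).

Lemma peak_gt0 v : 0 < v -> 0 < peak v.
Proof. by move=> v0; rewrite normal_peak_gt0// gt_eqF// sqrtr_gt0. Qed.

Lemma peakM v c : 0 < v -> 0 < c -> peak v = Num.sqrt c * peak (c * v).
Proof.
move=> v0 c0; rewrite /peak /normal_peak !sqr_sqrtr ?mulr_ge0// ?ltW//.
rewrite (_ : c * v * pi *+ 2 = c * (v * pi *+ 2)); last by rewrite -mulrA mulrnAr.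
rewrite sqrtrM ?ltW// invfM mulrA divff ?mul1r//.
by rewrite gt_eqF// sqrtr_gt0.
Qed.

Lemma phiE v m x : 0 < v -> phi v m x = peak v * expR (- ((x - m) ^+ 2 / (2 * v))).
Proof.
move=> v0; rewrite /phi normal_pdfE ?gt_eqF ?sqrtr_gt0// /normal_fun.
by rewrite sqr_sqrtr ?ltW// mulNr mulr_natl.
Qed.

Lemma phi_gt0 v m x : 0 < v -> 0 < phi v m x.
Proof. by move=> v0; rewrite phiE// mulr_gt0 ?expR_gt0 ?peak_gt0. Qed.

Lemma phi_ge0 v m x : 0 <= phi v m x.
Proof. exact: normal_pdf_ge0. Qed.

Lemma phi_le_peak v m x : 0 < v -> phi v m x <= peak v.
Proof. by move=> v0; rewrite normal_pdf_ub// gt_eqF// sqrtr_gt0. Qed.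

Lemma phiC v m x : 0 < v -> phi v m x = phi v x m.
Proof. by move=> v0; rewrite !phiE// -[in LHS]sqrrN opprB. Qed.

Lemma integral_phi v m : 0 < v ->
  (\int[@lebesgue_measure R]_x (phi v m x)%:E = 1)%E.
Proof. by move=> v0; rewrite integral_normal_pdf// gt_eqF// sqrtr_gt0. Qed.

Lemma measurable_phi v m : measurable_fun [set: measurableTypeR R] (phi v m).
Proof. exact: measurable_normal_pdf. Qed.

Lemma measurable_phi_mean v x : 0 < v ->
  measurable_fun [set: measurableTypeR R] (fun m => phi v m x).
Proof.
move=> v0; rewrite (_ : (fun m => _) = phi v x); first exact: measurable_phi.
by apply/funext => m; rewrite phiC.
Qed.

Lemma measurable_phiV v m : 0 < v ->
  measurable_fun [set: measurableTypeR R] (fun x => (phi v m x)^-1).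
Proof.
move=> v0; rewrite (_ : (fun x => _) =
    (fun x => (peak v)^-1 * expR ((x - m) ^+ 2 / (2 * v)))).
  apply: measurable_funM => //; apply: measurableT_comp => //.
  apply: measurable_funM => //; apply: measurable_funX.
  exact: measurable_funB.
by apply/funext => x; rewrite phiE// invfM -expRN opprK.
Qed.

Lemma measurable_phi2 v : 0 < v ->
  measurable_fun [set: measurableTypeR R * measurableTypeR R]
    (fun z => phi v z.1 z.2).
Proof.
move=> v0; rewrite [X in measurable_fun _ X](_ : _ = fun z =>
    peak v * expR (- ((z.2 - z.1) ^+ 2 / (2 * v)))); last first.
  by apply/funext => z; rewrite phiE.
apply: measurable_funM => //; apply: measurableT_comp => //.
apply: measurableT_comp => //; apply: measurable_funM => //.
apply: measurable_funX; apply: measurable_funB.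
  exact: measurable_snd.
exact: measurable_fst.
Qed.

(** The integrand is [sqrt c] times the density of N(0, c v). *)
Lemma integral_expR_phi v c : 0 < v -> 0 < c ->
  (\int[@lebesgue_measure R]_x
     (expR ((1 - c^-1) * x ^+ 2 / (2 * v)) * phi v 0 x)%:E = (Num.sqrt c)%:E)%E.
Proof.
move=> v0 c0.
transitivity (\int[@lebesgue_measure R]_x
   ((Num.sqrt c)%:E * (phi (c * v) 0 x)%:E))%E.
  apply: eq_integral => x _; rewrite -EFinM !phiE ?mulr_gt0//.
  rewrite (peakM _ _ v0 c0) mulrCA -!mulrA -expRD; congr (_ * (_ * expR _))%:E.
  by field; rewrite !gt_eqF.
rewrite ge0_integralZl//=; last 2 first.
- by apply/measurable_EFinP; exact: measurable_phi.
- by move=> x _; rewrite lee_fin phi_ge0.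
by rewrite integral_phi ?mulr_gt0// mule1.
Qed.

(** Half of the Gaussian exponent absorbs the square, through [u <= expR u]; the other half leaves a
    density N(m, 2 v). This costs the constant 8 in place of 1. *)
Lemma second_moment_phi v m : 0 < v ->
  (\int[@lebesgue_measure R]_x ((x - m) ^+ 2 * phi v m x)%:E <= (8 * v)%:E)%E.
Proof.
move=> v0; have v2 : 0 < 2 * v by rewrite mulr_gt0.
apply: (@le_trans _ _ (\int[@lebesgue_measure R]_x
   ((8 * v)%:E * (phi (2 * v) m x)%:E))%E).
  apply: le_integral_pointwise => x; rewrite -EFinM lee_fin !phiE//.
  rewrite (peakM _ 2 v0)//.
  set p := peak _; set z := (x - m) ^+ 2.
  have p0 : 0 < p by exact: peak_gt0.
  have s2 : Num.sqrt 2 <= 2 :> R.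
    have := sqr_sqrtr (ler0n R 2); have := sqrtr_ge0 (2 : R); nra.
  have e1 : z / (4 * v) <= expR (z / (4 * v)).
    by apply: le_trans (expR_ge1Dx _); rewrite lerDr.
  have z0 : 0 <= z by exact: sqr_ge0.
  have -> : expR (- (z / (2 * v))) =
      expR (- (z / (4 * v))) * expR (- (z / (4 * v))).
    by rewrite -expRD; congr expR; field; rewrite gt_eqF.
  have -> : 2 * (2 * v) = 4 * v by ring.
  set e := expR (- _).
  have e0 : 0 < e by exact: expR_gt0.
  have ze : z * e <= 4 * v.
    have : z / (4 * v) * e <= 1.
      rewrite /e expRN -ler_pdivlMr ?invr_gt0 ?expR_gt0// invrK mul1r.
      exact: e1.
    by rewrite mulrAC ler_pdivrMr ?mulr_gt0// mul1r.
  rewrite [leLHS](_ : _ = (Num.sqrt 2 * (z * e)) * (p * e)); last by ring.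
  apply: ler_wpM2r; first by rewrite mulr_ge0// ltW.
  rewrite (_ : 8 * v = 2 * (4 * v)); last by ring.
  by apply: ler_pM => //; rewrite mulr_ge0// ltW.
rewrite ge0_integralZl//=; last 3 first.
- by apply/measurable_EFinP; exact: measurable_phi.
- by move=> x _; rewrite lee_fin phi_ge0.
- by rewrite lee_fin mulr_ge0// ltW.
by rewrite integral_phi// mule1.
Qed.

(** The shape in which noise errors are integrated, first over y and then over x; [b] may contain
    the squared noise that is held fixed. *)
Lemma integral_quadratic_phi v m a b : 0 < v -> 0 <= a -> 0 <= b ->
  (\int[@lebesgue_measure R]_x ((a * (b + (x - m) ^+ 2)) * phi v m x)%:E
   <= (a * (b + 8 * v))%:E)%E.
Proof.
move=> v0 a0 b0.
rewrite (eq_integral (fun x : measurableTypeR R => a%:E * (b%:E * (phi v m x)%:E +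
    ((x - m) ^+ 2 * phi v m x)%:E))%E); last first.
  move=> x _.
  transitivity ((a * (b * phi v m x + (x - m) ^+ 2 * phi v m x))%:E) => //.
  by congr EFin; ring.
have m1 : measurable_fun [set: measurableTypeR R] (fun x => b%:E * (phi v m x)%:E)%E.
  by apply/measurable_EFinP/measurable_funM => //; exact: measurable_phi.
have m2 : measurable_fun [set: measurableTypeR R]
    (fun x => ((x - m) ^+ 2 * phi v m x)%:E).
  apply/measurable_EFinP/measurable_funM; last exact: measurable_phi.
  by apply: measurable_funX; exact: measurable_funB.
have p1 (x : R) : (0 <= b%:E * (phi v m x)%:E)%E by rewrite mule_ge0// lee_fin phi_ge0.
have p2 (x : R) : (0 <= ((x - m) ^+ 2 * phi v m x)%:E)%E.
  by rewrite lee_fin mulr_ge0 ?sqr_ge0 ?phi_ge0.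
rewrite ge0_integralZl//=; last 2 first.
- exact: emeasurable_funD.
- by move=> x _; rewrite adde_ge0.
rewrite ge0_integralD//= ge0_integralZl//=; last 2 first.
- by apply/measurable_EFinP; exact: measurable_phi.
- by move=> x _; rewrite lee_fin phi_ge0.
rewrite integral_phi// mule1 EFinM; apply: lee_wpmul2l; first by rewrite lee_fin.
by rewrite EFinD leeD2l// second_moment_phi.
Qed.

End gaussian_density.
Arguments phi {R} v m x.
Arguments peak {R} v.

(** * Risk bounds and Bayes estimates for product priors *)

Section risk_bounds.
Context (R : realType) (n : nat) (r : R) (r_gt0 : 0 < r).
Variables (theta : Rn R n) (phat : Rn R n -> Rn R n -> R).
Variables (f : 'I_n -> R -> R -> R) (F : 'I_n -> R -> R) (S : 'I_n -> R).
Local Notation leb := (@lebesgue_measure R).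
Local Notation th i := (tnth theta i).
Hypothesis mf : forall i x, measurable_fun [set: measurableTypeR R] (f i x).
Hypothesis f0 : forall i x y, 0 <= f i x y.
Hypothesis mF : forall i, measurable_fun [set: measurableTypeR R] (F i).
Hypothesis F0 : forall i x, 0 <= F i x.
Hypothesis fF : forall i x,
  (\int[leb]_y (f i x y * phi r (th i) y)%:E <= (F i x)%:E)%E.
Hypothesis FS : forall i,
  (\int[leb]_x (F i x * phi 1 (th i) x)%:E <= (S i)%:E)%E.

Let mphi v i : measurable_fun [set: measurableTypeR R] (phi v (th i)).
Proof. exact: measurable_phi. Qed.

Let phi0 v i x : 0 <= phi v (th i) x.
Proof. exact: phi_ge0. Qed.

Let phi1 v : 0 < v -> forall i, (\int[leb]_x (phi v (th i) x)%:E = 1)%E.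
Proof. by move=> v0 i; exact: integral_phi. Qed.

(** The error [f] is integrated over y, giving at most [F], then [F] over x, giving at most [S];
    each stage is one use of [integral_tensor_power_csum]. *)
Lemma risk_ge (c : R) :
  (forall x y, ((c - \sum_(i < n) f i (tnth x i) (tnth y i))%:E <=
     lne ((gauss_pdf theta r y)%:E / (phat x y)%:E))%E) ->
  ((c - \sum_(i < n) S i)%:E <= risk r theta phat)%E.
Proof.
move=> lb; apply: le_trans.
  exact: (@integral_tensor_power_csum _ _ _ leb n
    (fun i => phi 1 (th i)) F (mphi 1) (phi0 1) (phi1 _ ltr01) mF F0 c S FS).
apply: le_integral_pointwise => x; rewrite EFinM.
apply: lee_wpmul2r; first by rewrite lee_fin gauss_pdf_ge0.
apply: le_trans.
  exact: (@integral_tensor_power_csum _ _ _ leb n (fun i => phi r (th i))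
    (fun i => f i (tnth x i)) (mphi r) (phi0 r) (phi1 _ r_gt0)
    (fun i => mf i (tnth x i)) (fun i => f0 i (tnth x i)) c
    (fun i => F i (tnth x i)) (fun i => fF i (tnth x i))).
apply: le_integral_pointwise => y; rewrite EFinM muleC.
by apply: lee_wpmul2l; first by rewrite lee_fin gauss_pdf_ge0.
Qed.

Lemma risk_le :
  (forall x y, (lne ((gauss_pdf theta r y)%:E / (phat x y)%:E) <=
    (\sum_(i < n) f i (tnth x i) (tnth y i))%:E)%E) ->
  (risk r theta phat <= (\sum_(i < n) S i)%:E)%E.
Proof.
move=> ub; apply: (@le_trans _ _ (\int[@lebesgue_n R n]_x
    ((\sum_(i < n) F i (tnth x i)) * \prod_(j < n) phi 1 (th j) (tnth x j))%:E)%E);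
  last first.
  rewrite (@integral_tensor_power_sum _ _ _ leb n
    (fun i => phi 1 (th i)) F (mphi 1) (phi0 1) (phi1 _ ltr01) mF F0).
  by rewrite -sumEFin; apply: lee_sum => i _; exact: FS.
apply: le_integral_pointwise => x; rewrite EFinM.
apply: lee_wpmul2r; first by rewrite lee_fin gauss_pdf_ge0.
apply: (@le_trans _ _ (\int[@lebesgue_n R n]_y
    ((\sum_(i < n) f i (tnth x i) (tnth y i)) *
     \prod_(j < n) phi r (th j) (tnth y j))%:E)%E); last first.
  rewrite (@integral_tensor_power_sum _ _ _ leb n (fun i => phi r (th i))
    (fun i => f i (tnth x i)) (mphi r) (phi0 r) (phi1 _ r_gt0)
    (fun i => mf i (tnth x i)) (fun i => f0 i (tnth x i))).
  by rewrite -sumEFin; apply: lee_sum => i _; exact: fF.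
apply: le_integral_pointwise => y; rewrite [leRHS]EFinM [leRHS]muleC.
by apply: lee_wpmul2l; first by rewrite lee_fin gauss_pdf_ge0.
Qed.

End risk_bounds.

Section bayes_product.
Context (R : realType) (P : probability (measurableTypeR R) R).
Implicit Types (r x y : R).

Definition marginal x : R := fine (\int[P]_m (phi 1 m x)%:E).
Definition joint r x y : R := fine (\int[P]_m (phi 1 m x * phi r m y)%:E).

Let mphiM r x y : 0 < r ->
  measurable_fun [set: measurableTypeR R] (fun m => phi 1 m x * phi r m y).
Proof. by move=> r0; apply: measurable_funM; exact: measurable_phi_mean. Qed.

Lemma integral_prob_le (g : R -> R) c :
  (forall m, g m <= c) -> (\int[P]_m (g m)%:E <= c%:E)%E.
Proof.
move=> gc; rewrite -[leRHS]mule1 -(@probability_setT _ _ _ P).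
rewrite -integral_cst//; apply: le_integral_pointwise => m.
by rewrite lee_fin.
Qed.

Lemma marginalE x : (\int[P]_m (phi 1 m x)%:E = (marginal x)%:E)%E.
Proof.
rewrite fineK// ge0_fin_numE; last by apply: integral_ge0 => m _; rewrite lee_fin phi_ge0.
apply: le_lt_trans (integral_prob_le _ (peak 1) _) (ltry _) => m.
exact: phi_le_peak.
Qed.

Lemma jointE r x y : 0 < r ->
  (\int[P]_m (phi 1 m x * phi r m y)%:E = (joint r x y)%:E)%E.
Proof.
move=> r0; rewrite fineK// ge0_fin_numE; last first.
  by apply: integral_ge0 => m _; rewrite lee_fin mulr_ge0// phi_ge0.
apply: le_lt_trans (integral_prob_le _ (peak 1 * peak r) _) (ltry _) => m.
by apply: ler_pM; rewrite ?phi_ge0// phi_le_peak.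
Qed.

Lemma joint_ge0 r x y : 0 <= joint r x y.
Proof.
by apply: fine_ge0; apply: integral_ge0 => m _; rewrite lee_fin mulr_ge0 ?phi_ge0.
Qed.

Lemma marginal_ge0 x : 0 <= marginal x.
Proof. by apply: fine_ge0; apply: integral_ge0 => m _; rewrite lee_fin phi_ge0. Qed.

Lemma measurable_joint r x : 0 < r ->
  measurable_fun [set: measurableTypeR R] (joint r x).
Proof.
move=> r0; apply: measurableT_comp => //.
apply: (@measurable_fun_fubini_tonelli_F _ _ (measurableTypeR R) (measurableTypeR R) R P
  (fun z => (phi 1 z.2 x * phi r z.2 z.1)%:E)) => [|z]; last first.
  by rewrite lee_fin mulr_ge0 ?phi_ge0.
apply/measurable_EFinP/measurable_funM.
  by apply: (measurableT_comp (measurable_phi_mean R 1 x ltr01)); exact: measurable_snd.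
rewrite (_ : (fun z => _) = (fun z : measurableTypeR R * measurableTypeR R => phi r z.1 z.2)).
  exact: measurable_phi2.
by apply/funext => z; rewrite phiC.
Qed.

Lemma measurable_marginal : measurable_fun [set: measurableTypeR R] marginal.
Proof.
apply: measurableT_comp => //.
apply: (@measurable_fun_fubini_tonelli_F _ _ (measurableTypeR R) (measurableTypeR R) R P
  (fun z => (phi 1 z.2 z.1)%:E)) => [|z]; last by rewrite lee_fin phi_ge0.
apply/measurable_EFinP.
rewrite (_ : (fun z => _) = (fun z : measurableTypeR R * measurableTypeR R => phi 1 z.1 z.2)).
  exact: measurable_phi2.
by apply/funext => z; rewrite phiC.
Qed.

Lemma integral_joint r x : 0 < r ->
  (\int[@lebesgue_measure R]_y (joint r x y)%:E = (marginal x)%:E)%E.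
Proof.
move=> r0; under eq_integral do rewrite -jointE//.
rewrite (@fubini_tonelli _ _ (measurableTypeR R) (measurableTypeR R) R lebesgue_measure P
  (fun z => (phi 1 z.2 x * phi r z.2 z.1)%:E))/=; last 2 first.
- apply/measurable_EFinP/measurable_funM.
    by apply: (measurableT_comp (measurable_phi_mean R 1 x ltr01)); exact: measurable_snd.
  rewrite (_ : (fun z => _) = (fun z : measurableTypeR R * measurableTypeR R => phi r z.1 z.2)).
    exact: measurable_phi2.
  by apply/funext => z; rewrite phiC.
- by move=> z; rewrite lee_fin mulr_ge0 ?phi_ge0.
rewrite -marginalE; apply: eq_integral => m _.
under eq_integral do rewrite EFinM.
rewrite ge0_integralZl//=; last 3 first.
- by apply/measurable_EFinP; exact: measurable_phi.
- by move=> y _; rewrite lee_fin phi_ge0.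
- by rewrite lee_fin phi_ge0.
by rewrite integral_phi// mule1.
Qed.

Lemma integral_marginal : (\int[@lebesgue_measure R]_x (marginal x)%:E = 1)%E.
Proof.
under eq_integral do rewrite -marginalE.
rewrite (@fubini_tonelli _ _ (measurableTypeR R) (measurableTypeR R) R lebesgue_measure P
  (fun z => (phi 1 z.2 z.1)%:E))/=; last 2 first.
- apply/measurable_EFinP.
  rewrite (_ : (fun z => _) = (fun z : measurableTypeR R * measurableTypeR R => phi 1 z.1 z.2)).
    exact: measurable_phi2.
  by apply/funext => z; rewrite phiC.
- by move=> z; rewrite lee_fin phi_ge0.
under eq_integral do rewrite integral_phi//.
by rewrite integral_cst// mul1e; exact: (@probability_setT _ _ _ P).
Qed.

(** For a product prior, the integral of the likelihood of (x, y) and the evidence [D] both factor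
    over the coordinates. *)
Lemma bayes_predictiveE n r (x y : Rn R n) : 0 < r ->
  (forall i, 0 < marginal (tnth x i)) ->
  bayes_predictive r (tensor_power P n) x y =
  \prod_(i < n) (joint r (tnth x i) (tnth y i) / marginal (tnth x i)).
Proof.
move=> r0 marg_gt0.
pose D := \prod_(i < n) marginal (tnth x i).
have D0 : 0 < D by exact: prodr_gt0.
have evE : unnormalized_posterior (tensor_power P n) x setT = D%:E.
  rewrite /unnormalized_posterior (@integral_tensor_power_prod _ _ _ P n
    (fun i m => phi 1 m (tnth x i)))//.
  - by rewrite -prodEFin; apply: eq_bigr => i _; exact: marginalE.
  - by move=> i; exact: measurable_phi_mean.
  - by move=> i m; exact: phi_ge0.
(* The evidence is the positive real [D], which excludes the two cases where [mnormalize] returns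
   its default. *)
have postE A : mnormalize (unnormalized_posterior (tensor_power P n) x)
    (tensor_power P n) A = (unnormalized_posterior (tensor_power P n) x A * D^-1%:E)%E.
  rewrite /mnormalize; case: ifPn => [/orP[/eqP e0|/eqP eoo]|_].
  - by move: (etrans (esym evE) e0) => /eqP; rewrite eqe gt_eqF.
  - by move: (etrans (esym evE) eoo).
  - by congr (_ * (_)^-1%:E)%E; rewrite -[RHS]/(fine D%:E); congr fine; exact: evE.
have mg : measurable_fun setT (fun t : Rn R n => gauss_pdf t 1 x).
  exact: measurable_gauss_pdf_mean.
rewrite /bayes_predictive /Rintegral.
rewrite (@integral_with_density _ _ _ (tensor_power P n)
   (posterior (tensor_power P n) x) (fun t => gauss_pdf t 1 x / D)); last 5 first.
- by apply: measurable_funM.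
- by move=> t; rewrite mulr_ge0 ?gauss_pdf_ge0// invr_ge0 ltW.
- move=> A mA; transitivity (unnormalized_posterior (tensor_power P n) x A * D^-1%:E)%E.
    exact: postE.
  under eq_integral do rewrite EFinM.
  rewrite ge0_integralZr//.
  + by apply/measurable_EFinP/measurable_funTS.
  + by move=> t _; rewrite lee_fin gauss_pdf_ge0.
  + by rewrite lee_fin invr_ge0 ltW.
- by apply/measurable_EFinP; exact: measurable_gauss_pdf_mean.
- by move=> t; rewrite lee_fin gauss_pdf_ge0.
pose h (i : 'I_n) m := phi 1 m (tnth x i) * phi r m (tnth y i).
have mh i : measurable_fun [set: measurableTypeR R] (h i) by exact: mphiM.
have h0 i m : 0 <= h i m by rewrite mulr_ge0 ?phi_ge0.
transitivity (fine (\int[tensor_power P n]_t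
    ((\prod_(i < n) h i (tnth t i))%:E * D^-1%:E))%E).
  congr fine; apply: eq_integral => t _; rewrite -!EFinM; congr EFin.
  by rewrite /h big_split/= mulrA [X in X * _]mulrC.
rewrite ge0_integralZr//=; last 3 first.
- apply/measurable_EFinP/measurable_prod => i _.
  by apply: measurableT_comp (mh i) _; exact: measurable_tnth.
- by move=> t _; rewrite lee_fin prodr_ge0.
- by rewrite lee_fin invr_ge0 ltW.
rewrite (@integral_tensor_power_prod _ _ _ P n h mh h0).
transitivity (fine ((\prod_(i < n) joint r (tnth x i) (tnth y i))%:E * D^-1%:E)%E).
  by rewrite -prodEFin; congr (fine (_ * _)); apply: eq_bigr => i _; exact: jointE.
by rewrite -EFinM/= big_split/= prodfV.
Qed.

End bayes_product.
Arguments marginal {R} P x.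
Arguments joint {R} P r x y.

(** * Spike-and-slab marginals *)

(** Positive factors keep the extended logarithm finite, so the log-likelihood ratio splits into a
    sum over coordinates. *)
Lemma lne_gauss_pdf_div (R : realType) n (r : R) (theta y : Rn R n) (q : 'I_n -> R) :
  0 < r -> (forall i, 0 < q i) ->
  lne ((gauss_pdf theta r y)%:E / (\prod_(i < n) q i)%:E)%E =
  (\sum_(i < n) ln (phi r (tnth theta i) (tnth y i) / q i))%:E.
Proof.
move=> r0 q0; rewrite inver gt_eqF ?prodr_gt0// -EFinM.
rewrite -prodfV -[gauss_pdf _ _ _]/(\prod_(i < n) phi r (tnth theta i) (tnth y i)).
rewrite -big_split lne_EFin/=; last first.
  by apply: prodr_gt0 => i _; rewrite divr_gt0// phi_gt0.
congr EFin; apply: expR_inj; rewrite lnK ?expR_sum; last first.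
  by rewrite posrE; apply: prodr_gt0 => i _; rewrite divr_gt0// phi_gt0.
by apply: eq_bigr => i _; rewrite lnK// posrE divr_gt0// phi_gt0.
Qed.

Section spike_slab_marginals.
Context (R : realType) (eta : {i01 R}) (l : {posnum R}).
Let e := eta%:num.
Local Notation P := (spike_slab eta l).

Let e_ge0 : 0 <= e. Proof. by rewrite /e. Qed.

Let e_le1 : e <= 1. Proof. by rewrite /e. Qed.

Lemma integral_spike_slab (g : R -> R) :
  measurable_fun [set: measurableTypeR R] g -> (forall m, 0 <= g m) ->
  (\int[P]_m (g m)%:E = (1 - e)%:E * (g 0)%:E +
    e%:E * ((2 * l%:num)^-1%:E *
      \int[@lebesgue_measure R]_(m in `[(- l%:num)%R, l%:num]) (g m)%:E))%E.
Proof.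
move=> mg g0; have mgE : measurable_fun [set: measurableTypeR R] (fun m => (g m)%:E).
  exact/measurable_EFinP.
rewrite /spike_slab ge0_integral_measure_add//; last by move=> m _; rewrite lee_fin.
rewrite !ge0_integral_mscale//; last 2 first.
- by move=> m _; rewrite lee_fin.
- by move=> m _; rewrite lee_fin.
rewrite integral_dirac// diracT mul1e integral_uniform//.
by rewrite opprK -mulr2n -[_ *+ 2]mulr_natl/=.
Qed.

Lemma marginal_spike_slab_ge x : (1 - e) * phi 1 0 x <= marginal P x.
Proof.
rewrite -lee_fin -marginalE integral_spike_slab//; last first.
- by move=> m; exact: phi_ge0.
- exact: measurable_phi_mean.
rewrite EFinM leeDl//; apply: mule_ge0; first by rewrite lee_fin.
apply: mule_ge0; first by rewrite lee_fin invr_ge0 ltW// mulr_gt0.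
by apply: integral_ge0 => m _; rewrite lee_fin phi_ge0.
Qed.

Let measurable_phiM (r x y : R) : 0 < r ->
  measurable_fun [set: measurableTypeR R] (fun m => phi 1 m x * phi r m y).
Proof. by move=> r0; apply: measurable_funM; exact: measurable_phi_mean. Qed.

Let phiM_ge0 (r x y m : R) : 0 <= phi 1 m x * phi r m y.
Proof. by rewrite mulr_ge0 ?phi_ge0. Qed.

Lemma joint_spike_slab_ge r x y : 0 < r ->
  (1 - e) * (phi 1 0 x * phi r 0 y) <= joint P r x y.
Proof.
move=> r0; rewrite -lee_fin -jointE// integral_spike_slab//; last exact: measurable_phiM.
rewrite EFinM leeDl//; apply: mule_ge0; first by rewrite lee_fin.
apply: mule_ge0; first by rewrite lee_fin invr_ge0 ltW// mulr_gt0.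
by apply: integral_ge0 => m _; rewrite lee_fin.
Qed.

(** Bound for a wide slab: the slab has density at most [e / (2 l)], the factor in y is at most
    [peak r], and the factor in x integrates to 1 over all means. *)
Lemma joint_spike_slab_le r x y : 0 < r ->
  joint P r x y <= phi 1 0 x * phi r 0 y + e / (2 * l%:num) * peak r.
Proof.
move=> r0; rewrite -lee_fin -jointE// integral_spike_slab//; last exact: measurable_phiM.
rewrite [leRHS]EFinD; apply: leeD.
  by rewrite -EFinM lee_fin ler_piMl// gerBl.
rewrite [leRHS]EFinM [leLHS]muleA -[(e%:E * _)%E]EFinM; apply: lee_wpmul2l.
  by rewrite lee_fin mulr_ge0// invr_ge0 ltW// mulr_gt0.
rewrite integral_mkcond.
apply: (@le_trans _ _ (\int[@lebesgue_measure R]_m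
    ((peak r)%:E * (phi 1 x m)%:E))%E).
  apply: le_integral_pointwise => m; rewrite patchE -EFinM.
  case: ifPn => _; rewrite lee_fin; last first.
    by rewrite mulr_ge0 ?phi_ge0// ltW// peak_gt0.
  by rewrite mulrC (phiC _ 1)// ler_wpM2r ?phi_ge0// phi_le_peak.
rewrite ge0_integralZl//=.
- by rewrite integral_phi// mule1.
- by apply/measurable_EFinP; exact: measurable_phi.
- by move=> m _; rewrite lee_fin phi_ge0.
- by rewrite lee_fin ltW// peak_gt0.
Qed.

(** Bound for a narrow slab: the whole prior, spike included, is carried by [[-l, l]]. *)
Lemma joint_spike_slab_sup r x y B : 0 < r ->
  (forall m, `|m| <= l%:num -> phi 1 m x * phi r m y <= B) ->
  joint P r x y <= B.
Proof.
move=> r0 le_B; rewrite -lee_fin -jointE// integral_spike_slab//; last exact: measurable_phiM.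
have le0B : phi 1 0 x * phi r 0 y <= B by apply: le_B; rewrite normr0.
(* [B] is written as its own average under the spike and the slab, for a comparison term by term. *)
have -> : B = (1 - e) * B + e * ((2 * l%:num)^-1 * (B * (2 * l%:num))).
  by field; rewrite gt_eqF.
rewrite [leRHS]EFinD; apply: leeD.
  by rewrite -EFinM lee_fin ler_wpM2l// subr_ge0.
rewrite EFinM [X in (_ <= _ * X)%E]EFinM; apply: lee_wpmul2l; first by rewrite lee_fin.
apply: lee_wpmul2l; first by rewrite lee_fin invr_ge0 ltW// mulr_gt0.
apply: (@le_trans _ _ (\int[@lebesgue_measure R]_(m in `[(- l%:num)%R, l%:num]) B%:E)%E).
  rewrite integral_mkcond [leRHS]integral_mkcond; apply: le_integral_pointwise => m.
  rewrite !patchE; case: ifPn => //; rewrite inE/= in_itv/= => ml.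
  by rewrite lee_fin le_B// ler_norml.
rewrite integral_cst//= lebesgue_measure_itv/= lte_fin gtrN//.
by rewrite -EFinB opprK -mulr2n -[_ *+ 2]mulr_natl.
Qed.

End spike_slab_marginals.

(** * Risk of the spike-and-slab estimate at equal signals *)

Section spike_slab_risk.
Context (R : realType) (eta : {i01 R}) (l : {posnum R}).
Variables (n s : nat) (r mu K A : R).
Let e := eta%:num.
Local Notation P := (spike_slab eta l).
Hypothesis e_lt1 : e < 1.
Hypothesis r_gt0 : 0 < r.
Hypothesis sn : (s <= n)%N.
Hypothesis mu_ge0 : 0 <= mu.
Hypothesis A_ge0 : 0 <= A.
Hypothesis joint_le : forall x y, joint P r x y <=
  phi 1 mu x * phi r mu y * expR (- K + A * ((x - mu) ^+ 2 + (y - mu) ^+ 2)).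

Definition first_coords : Rn R n :=
  [tuple (if (i < s)%N then mu else 0) | i < n].

Let e1_gt0 : 0 < 1 - e. Proof. by rewrite subr_gt0. Qed.

Let marginal_gt0 x : 0 < marginal P x.
Proof.
apply: lt_le_trans (marginal_spike_slab_ge _ _ _ x).
by rewrite mulr_gt0// phi_gt0.
Qed.

Let joint_gt0 x y : 0 < joint P r x y.
Proof.
apply: lt_le_trans (joint_spike_slab_ge _ _ _ r x y r_gt0).
by rewrite !mulr_gt0// phi_gt0.
Qed.

Let A' := A + mu / 2.

Let A'_ge0 : 0 <= A'. Proof. by rewrite addr_ge0// divr_ge0. Qed.

(** The gain [K] comes from [joint_le]. The marginal of x is at least its spike part, which costs
    [mu ^+ 2 / 2 + mu * z] for the noise [z = x - mu]; the cross term is at most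
    [mu * (1 + z ^+ 2) / 2], hence [A']. *)
Let log_ratio_active x y :
  ln (1 - e) + K - mu ^+ 2 / 2 - mu / 2 - A' * ((x - mu) ^+ 2 + (y - mu) ^+ 2)
  <= ln (phi r mu y / (joint P r x y / marginal P x)).
Proof.
rewrite -ler_expR lnK; last first.
  by rewrite posrE !divr_gt0// phi_gt0.
rewrite invf_div mulrA ler_pdivlMr//.
set c := (X in expR X).
apply: (@le_trans _ _ (phi r mu y * ((1 - e) * phi 1 0 x))); last first.
  by rewrite ler_wpM2l ?phi_ge0// marginal_spike_slab_ge.
apply: (le_trans (ler_wpM2l (expR_ge0 _) (joint_le x y))).
rewrite mulrCA -expRD [X in X * _]mulrC -mulrA; apply: ler_wpM2l; first exact: phi_ge0.
rewrite -[1 - e]lnK ?posrE// !phiE// mulrCA -mulrA -!expRD.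
apply: ler_wpM2l; first by rewrite ltW// peak_gt0.
rewrite ler_expR /c /A'.
have := sqr_ge0 (x - mu - 1); have := sqr_ge0 (y - mu).
set z := x - mu; have -> : x = z + mu by rewrite subrK.
set w := y - mu => w0 z1; rewrite subr0.
have : 0 <= mu * (z - 1) ^+ 2 by rewrite mulr_ge0.
have : 0 <= mu * w ^+ 2 by rewrite mulr_ge0.
lra.
Qed.

(** The inequality [ln u <= u - 1] is applied to the ratio [u] of the joint density to the true one.
    Since [u] has mean 1 at a null coordinate, only [ln (1 - e)] is lost on average. *)
Let log_ratio_null x y :
  ln (1 - e) + 1 - joint P r x y / (phi 1 0 x * phi r 0 y)
  <= ln (phi r 0 y / (joint P r x y / marginal P x)).
Proof.
set u := joint P r x y / (phi 1 0 x * phi r 0 y).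
have u0 : 0 < u by rewrite divr_gt0// mulr_gt0// phi_gt0.
apply: (@le_trans _ _ (ln ((1 - e) / u))).
  rewrite ln_div ?posrE// -addrA lerD2l -opprB lerN2.
  by have := @le_ln1Dx R (u - 1); rewrite addrCA subrr addr0; apply; lra.
rewrite ler_ln ?posrE ?divr_gt0// ?phi_gt0//.
rewrite /u !invf_div !mulrA ler_pM2r ?invr_gt0//.
  rewrite [leRHS]mulrC; apply: ler_wpM2r; first exact: phi_ge0.
  exact: marginal_spike_slab_ge.
by rewrite mulr_gt0// phi_gt0.
Qed.

Lemma spike_slab_risk_ge :
  ((s%:R * (K - mu ^+ 2 / 2 - mu / 2 - (A + mu / 2) * (8 + 8 * r))
    + n%:R * ln (1 - e))%:E
   <= risk r first_coords (spike_slab_predictive n r eta l))%E.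
Proof.
(* At a null coordinate, integrating the joint density over y gives the marginal, whose integral
   over x is 1; this dictates [F] and [S]. *)
pose f (i : 'I_n) x y := if (i < s)%N then A' * ((x - mu) ^+ 2 + (y - mu) ^+ 2)
  else joint P r x y / (phi 1 0 x * phi r 0 y).
pose F (i : 'I_n) x := if (i < s)%N then A' * ((x - mu) ^+ 2 + 8 * r)
  else marginal P x / phi 1 0 x.
pose S (i : 'I_n) := if (i < s)%N then A' * (8 + 8 * r) else 1.
pose c (i : 'I_n) :=
  if (i < s)%N then ln (1 - e) + K - mu ^+ 2 / 2 - mu / 2 else ln (1 - e) + 1.
rewrite (_ : _ + _ = \sum_(i < n) c i - \sum_(i < n) S i); last first.
  rewrite -sumrB (eq_bigr (fun i : 'I_n => ln (1 - e) + if (i < s)%N then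
    K - mu ^+ 2 / 2 - mu / 2 - (A + mu / 2) * (8 + 8 * r) else 0)); last first.
    by move=> i _; rewrite /c /S; case: ifP => _; rewrite /A'; lra.
  rewrite big_split/= sumr_const card_ord -big_mkcond/= addrC mulr_natl.
  congr (_ + _); last by rewrite mulr_natl.
  rewrite -(big_ord_widen n (fun=> K - mu ^+ 2 / 2 - mu / 2 - (A + mu / 2) * (8 + 8 * r)))//.
  by rewrite sumr_const card_ord.
have thE (i : 'I_n) : tnth first_coords i = if (i < s)%N then mu else 0.
  by rewrite tnth_mktuple.
apply: (@risk_ge R n r r_gt0 _ _ f F S) => [i x|i x y|i|i x|i x|i|x y].
- rewrite /f; case: (i < s)%N.
    apply: measurable_funM => //; apply: measurable_funD => //.
    by apply: measurable_funX; exact: measurable_funB.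
  apply: measurable_funM; first exact: measurable_joint.
  rewrite (_ : (fun y => _) = fun y => (phi 1 0 x)^-1 * (phi r 0 y)^-1).
    by apply: measurable_funM => //; exact: measurable_phiV.
  by apply/funext => y; rewrite invfM.
- rewrite /f; case: (i < s)%N; first by rewrite mulr_ge0// addr_ge0// sqr_ge0.
  by rewrite divr_ge0 ?joint_ge0// mulr_ge0 ?phi_ge0.
- rewrite /F; case: (i < s)%N.
    apply: measurable_funM => //; apply: measurable_funD => //.
    by apply: measurable_funX; exact: measurable_funB.
  by apply: measurable_funM; [exact: measurable_marginal|exact: measurable_phiV].
- rewrite /F; case: (i < s)%N.
    by rewrite mulr_ge0// addr_ge0 ?sqr_ge0// mulr_ge0// ltW.
  by rewrite divr_ge0 ?marginal_ge0// phi_ge0.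
- rewrite thE /f /F; case: (i < s)%N.
    exact: (integral_quadratic_phi R r mu A' ((x - mu) ^+ 2) r_gt0 A'_ge0 (sqr_ge0 _)).
  rewrite (eq_integral (fun y : measurableTypeR R => (phi 1 0 x)^-1%:E * (joint P r x y)%:E)%E); last first.
    by move=> y _; rewrite -EFinM; congr EFin; field; rewrite !gt_eqF ?phi_gt0.
  rewrite ge0_integralZl//=.
  + by rewrite integral_joint// -EFinM mulrC.
  + by apply/measurable_EFinP; exact: measurable_joint.
  + by move=> y _; rewrite lee_fin joint_ge0.
  + by rewrite lee_fin invr_ge0 phi_ge0.
- rewrite thE /F /S; case: ifP => _.
    rewrite [X in (_ <= X%:E)%E](_ : _ = A' * (8 * r + 8 * 1)); last by rewrite mulr1 addrC.
    under eq_integral do rewrite addrC.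
    by apply: integral_quadratic_phi => //; rewrite mulr_ge0// ltW.
  rewrite (eq_integral (fun x : measurableTypeR R => (marginal P x)%:E)); last first.
    by move=> x _; congr EFin; field; rewrite !gt_eqF ?phi_gt0.
  by rewrite integral_marginal.
- rewrite /spike_slab_predictive bayes_predictiveE//.
  rewrite lne_gauss_pdf_div//; last by move=> i; rewrite divr_gt0.
  rewrite lee_fin -sumrB; apply: ler_sum => i _.
  by rewrite thE /c /f; case: ifP => _; [exact: log_ratio_active|exact: log_ratio_null].
Qed.

End spike_slab_risk.

(** * A mixture estimator with nearly minimax risk *)

Section adaptive_mixture.
Context (R : realType) (r c : R).
Hypothesis r_gt0 : 0 < r.
Hypothesis c_ge1 : 1 <= c.

Let kappa := 1 - (c ^+ 2)^-1.

(* With [c ^+ 2 = ln (1 / eta)], the odds are about [eta * expR (x ^+ 2 / 2)]; the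
   factor [kappa] makes them integrable against the standard normal law. *)
Definition slab_odds (x : R) : R := expR (- (kappa * (c ^+ 2 - x ^+ 2 / 2))).

Definition mixture_pdf (x y : R) : R :=
  (phi r 0 y + slab_odds x * phi r x y) / (1 + slab_odds x).

Let odds_gt0 x : 0 < slab_odds x. Proof. exact: expR_gt0. Qed.

Let odds1_gt0 x : 0 < 1 + slab_odds x. Proof. by rewrite addr_gt0. Qed.

Let mixture_gt0 x y : 0 < mixture_pdf x y.
Proof. by rewrite divr_gt0// addr_gt0 ?mulr_gt0// phi_gt0. Qed.

Let c_gt0 : 0 < c. Proof. exact: lt_le_trans c_ge1. Qed.

Let c2_ge1 : 1 <= c ^+ 2. Proof. exact: exprn_ege1. Qed.

Let kappa_ge0 : 0 <= kappa.
Proof. by rewrite subr_ge0 invf_le1// exprn_gt0. Qed.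

Let kappa_le1 : kappa <= 1.
Proof. by rewrite gerBl invr_ge0 sqr_ge0. Qed.

Let kappa_le (u v : R) : u <= v -> 0 <= v -> kappa * u <= v.
Proof.
move=> uv v0; apply: le_trans (ler_wpM2l kappa_ge0 uv) _.
by rewrite ler_piMl.
Qed.

Let measurable_slab_odds : measurable_fun [set: measurableTypeR R] slab_odds.
Proof.
apply: measurableT_comp => //; apply: measurableT_comp => //.
apply: measurable_funM => //; apply: measurable_funB => //.
by apply: measurable_funM => //; exact: measurable_funX.
Qed.

(** As [kappa * c ^+ 2 = c ^+ 2 - 1], the integrand is [expR (1 - c ^+ 2) * c] times the density of
    N(0, c ^+ 2). *)
Lemma integral_slab_odds :
  (\int[@lebesgue_measure R]_x (slab_odds x * phi 1 0 x)%:E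
   = (expR (1 - c ^+ 2) * c)%:E)%E.
Proof.
have kE : - (kappa * c ^+ 2) = 1 - c ^+ 2.
  by rewrite /kappa; field; rewrite gt_eqF.
rewrite (eq_integral (fun x : measurableTypeR R => (expR (1 - c ^+ 2))%:E *
    (expR ((1 - (c ^+ 2)^-1) * x ^+ 2 / (2 * 1)) * phi 1 0 x)%:E)%E); last first.
  move=> x _; rewrite -EFinM; congr EFin; rewrite mulrA -expRD; congr (expR _ * _).
  by rewrite -kE /kappa; field; rewrite gt_eqF.
rewrite ge0_integralZl//=.
- by rewrite integral_expR_phi// ?exprn_gt0// sqrtr_sqr gtr0_norm.
- apply/measurable_EFinP/measurable_funM; last exact: measurable_phi.
  apply: measurableT_comp => //; apply: measurable_funM => //.
  by apply: measurable_funM => //; exact: measurable_funX.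
- by move=> x _; rewrite lee_fin mulr_ge0 ?expR_ge0 ?phi_ge0.
Qed.

Lemma integral_mixture_pdf x :
  (\int[@lebesgue_measure R]_y (mixture_pdf x y)%:E = 1)%E.
Proof.
have mp m : measurable_fun [set: measurableTypeR R] (fun y => (phi r m y)%:E).
  by apply/measurable_EFinP; exact: measurable_phi.
have p0 m (y : R) : (0 <= (phi r m y)%:E)%E by rewrite lee_fin phi_ge0.
rewrite (eq_integral (fun y : measurableTypeR R => ((1 + slab_odds x)^-1)%:E *
  ((phi r 0 y)%:E + (slab_odds x)%:E * (phi r x y)%:E))%E); last first.
  move=> y _; transitivity
    ((1 + slab_odds x)^-1 * (phi r 0 y + slab_odds x * phi r x y))%:E => //.
  by congr EFin; rewrite mulrC.
have m2 : measurable_fun [set: measurableTypeR R]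
   (fun y => (slab_odds x)%:E * (phi r x y)%:E)%E.
  by apply/measurable_EFinP/measurable_funM => //; exact: measurable_phi.
have p2 (y : R) : (0 <= (slab_odds x)%:E * (phi r x y)%:E)%E.
  by rewrite mule_ge0// lee_fin ltW.
rewrite ge0_integralZl//=; last 3 first.
- exact: emeasurable_funD.
- by move=> y _; rewrite adde_ge0.
- by rewrite lee_fin invr_ge0 ltW.
rewrite ge0_integralD//= ge0_integralZl//=; last by rewrite lee_fin ltW.
by rewrite !integral_phi// mule1 -EFinD -EFinM mulVf// gt_eqF.
Qed.

Lemma measurable_mixture_pdf :
  measurable_fun [set: measurableTypeR R * measurableTypeR R]
    (fun z => mixture_pdf z.1 z.2).
Proof.
have mo : measurable_fun [set: measurableTypeR R * measurableTypeR R]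
    (fun z => slab_odds z.1).
  by apply: measurableT_comp => //; exact: measurable_fst.
apply: measurable_funM.
  apply: measurable_funD.
    by apply: (measurableT_comp (measurable_phi R r 0)); exact: measurable_snd.
  by apply: measurable_funM => //; exact: measurable_phi2.
(* The inverse of the positive denominator is rewritten with [expR] and [ln], whose measurability is
   at hand. *)
rewrite (_ : (fun z => _) = (fun z : measurableTypeR R * measurableTypeR R =>
    expR (- ln (1 + slab_odds z.1)))).
  apply: measurableT_comp => //; apply: measurableT_comp => //.
  by apply: measurableT_comp => //; exact: measurable_funD.
by apply/funext => z; rewrite expRN lnK// posrE.
Qed.

Definition mixture_predictive n (x y : Rn R n) : R :=
  \prod_(i < n) mixture_pdf (tnth x i) (tnth y i).

Lemma mixture_predictive_density n : predictive_density (@mixture_predictive n).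
Proof.
split => [|x y|x].
- apply: measurable_prod => i _.
  have mi : measurable_fun [set: Rn R n * Rn R n]
      (fun xy => (tnth xy.1 i, tnth xy.2 i) : measurableTypeR R * measurableTypeR R).
    apply/measurable_fun_pairP; split.
      exact: (measurableT_comp (measurable_tnth i) measurable_fst).
    exact: (measurableT_comp (measurable_tnth i) measurable_snd).
  exact: (measurableT_comp measurable_mixture_pdf mi).
- by apply: prodr_ge0 => i _; rewrite ltW.
- rewrite /lebesgue_n (@integral_tensor_power_prod _ _ _ (@lebesgue_measure R) n
    (fun i => mixture_pdf (tnth x i))).
  + by rewrite big1// => i _; exact: integral_mixture_pdf.
  + by move=> i; exact: (measurableT_comp measurable_mixture_pdf
      (measurable_pair1 _)).
  + by move=> i y; rewrite ltW.
Qed.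

(** Without its second component, the mixture bounds the ratio by [1 + slab_odds x], and
    [1 + u <= expR u]. *)
Lemma log_ratio_mixture_null x y : ln (phi r 0 y / mixture_pdf x y) <= slab_odds x.
Proof.
have p0 : 0 < phi r 0 y by exact: phi_gt0.
rewrite -ler_expR lnK ?posrE ?divr_gt0//.
apply: le_trans (expR_ge1Dx _).
rewrite ler_pdivrMr// mulrCA divff ?gt_eqF// mulr1.
  by rewrite lerDl mulr_ge0 ?phi_ge0// ltW.
by rewrite addr_gt0 ?mulr_gt0// phi_gt0.
Qed.

(** With [c ^+ 2 = ln (1 / eta)], the first term is the leading loss [ln (1 / eta) / (1 + r)]; the
    rest of [B0], and [B1], are of order [c]. *)
Let B0 := c ^+ 2 / (1 + r) + (2 + r^-1) * c.
Let B1 := (2 + r + 2 / r) * c.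

Let quadratic_facts (u : R) : 0 <= u ->
  [/\ u <= c * u, 0 <= c * u / r, u * r <= c * u * r, 0 <= u * r & u / r <= c * u / r].
Proof.
move=> u0; have cu : u <= c * u by rewrite ler_peMl.
have cu0 : 0 <= c * u by rewrite mulr_ge0// ltW.
split => //; first by rewrite divr_ge0// ltW.
- by rewrite ler_pM2r.
- by rewrite mulr_ge0// ltW.
- by rewrite ler_pM2r ?invr_gt0.
Qed.

(** Error budget when the component at 0 is kept: [u] and [w] are the squared noises of x and y, [p]
    is the cross term [(y - mu) * mu / r], [q0] is the loss [mu ^+ 2 / (2 * r)] and [q] its bound
    [c ^+ 2 / (1 + r)]. *)
Let bound_small (u w p q0 q : R) : 0 <= u -> 0 <= w ->
  p <= c / r + c * w / r -> q0 <= q ->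
  1 + (1 + r) * u / 2 + p + q0 <=
  q + (2 + r^-1) * c + (2 + r + 2 / r) * c * (u + w).
Proof.
move=> u0 w0 pw qq.
have [? ? ? ? ?] := quadratic_facts _ u0; have [? ? ? ? ?] := quadratic_facts _ w0.
move: c_ge1; lra.
Qed.

(** Error budget when the component at x is kept; here [p] is the product of the two noises divided
    by [r]. *)
Let bound_large (u w p q : R) : 0 <= u -> 0 <= w ->
  0 <= u / r + 2 * p + w / r ->
  1 + (q + c + c * u / 2) + u / r / 2 - p <=
  q + (2 + r^-1) * c + (2 + r + 2 / r) * c * (u + w).
Proof.
move=> u0 w0 pw; have cr : 0 <= c / r by rewrite divr_ge0// ltW.
have [? ? ? ? ?] := quadratic_facts _ u0; have [? ? ? ? ?] := quadratic_facts _ w0.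
move: c_ge1; lra.
Qed.

(** A single component of the mixture is kept, according to the signal. The threshold
    [mu ^+ 2 * (1 + r) = 2 * r * c ^+ 2] is where the two losses [mu ^+ 2 / (2 * r)] and
    [c ^+ 2 - mu ^+ 2 / 2] both equal [c ^+ 2 / (1 + r)]. *)
Lemma log_ratio_mixture x y mu :
  ln (phi r mu y / mixture_pdf x y) <= B0 + B1 * ((x - mu) ^+ 2 + (y - mu) ^+ 2).
Proof.
have phi_shift m (T : R) : T - (y - mu) ^+ 2 / (2 * r) <=
    B0 + B1 * ((x - mu) ^+ 2 + (y - mu) ^+ 2) - (y - m) ^+ 2 / (2 * r) ->
    phi r mu y * expR T <=
    expR (B0 + B1 * ((x - mu) ^+ 2 + (y - mu) ^+ 2)) * phi r m y.
  move=> TB; rewrite !phiE// mulrCA -mulrA -!expRD.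
  by apply: ler_wpM2l; [rewrite ltW// peak_gt0|rewrite ler_expR addrC].
have onepexp (u T : R) : u <= T -> 0 <= T -> 1 + expR u <= expR (1 + T).
  move=> uT T0; have e2 : 2 <= expR (1 : R) by apply: le_trans (expR_ge1Dx _).
  rewrite expRD; apply: (@le_trans _ _ (2 * expR T)); last first.
    by rewrite ler_wpM2r// expR_ge0.
  have : 1 <= expR T by rewrite -expR0 ler_expR.
  have : expR u <= expR T by rewrite ler_expR.
  lra.
have rV0 : 0 < r^-1 by rewrite invr_gt0.
have cV0 : 0 < c^-1 by rewrite invr_gt0.
rewrite -ler_expR lnK; last by rewrite posrE divr_gt0// phi_gt0.
rewrite /mixture_pdf invf_div mulrA ler_pdivrMr; last first.
  by rewrite addr_gt0 ?mulr_gt0// phi_gt0.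
set E := expR _.
have E0 : 0 < E by exact: expR_gt0.
have z0 := sqr_ge0 (x - mu); have w0 := sqr_ge0 (y - mu).
have [small|large] := lerP (mu ^+ 2 * (1 + r)) (2 * r * c ^+ 2).
  apply: (@le_trans _ _ (E * phi r 0 y)); last first.
    apply: ler_wpM2l; first exact: ltW.
    by rewrite lerDl mulr_ge0 ?phi_ge0// ltW.
  have mu2 : mu ^+ 2 / (2 * r) <= c ^+ 2 / (1 + r).
    by rewrite ler_pdivlMr ?addr_gt0// mulrAC ler_pdivrMr ?mulr_gt0// [leRHS]mulrC.
  have mu2' : mu ^+ 2 / r + mu ^+ 2 <= 2 * c ^+ 2.
    have -> : mu ^+ 2 / r + mu ^+ 2 = mu ^+ 2 * (1 + r) / r by field; rewrite gt_eqF.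
    by rewrite ler_pdivrMr// [leRHS]mulrAC.
  have T0 : 0 <= (1 + r) * (x - mu) ^+ 2 / 2.
    by rewrite divr_ge0// mulr_ge0 ?sqr_ge0// addr_ge0// ltW.
  apply: (@le_trans _ _ (phi r mu y * expR (1 + (1 + r) * (x - mu) ^+ 2 / 2))).
    apply: ler_wpM2l; first exact: phi_ge0.
    apply: onepexp; last exact: T0.
    rewrite -mulrN; apply: kappa_le; last exact: T0.
    (* This square bounds [x ^+ 2 / 2] by [(1 + r) * (x - mu) ^+ 2 / 2 + (mu ^+ 2 + mu ^+ 2 / r) /
       2], whose last term is at most [c ^+ 2] for a small signal. *)
    have : 0 <= (r * (x - mu) - mu) ^+ 2 / r by rewrite mulr_ge0 ?sqr_ge0// ltW.
    have -> : (r * (x - mu) - mu) ^+ 2 / r =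
        r * (x - mu) ^+ 2 - 2 * (x - mu) * mu + mu ^+ 2 / r.
      by field; rewrite gt_eqF.
    lra.
  apply: phi_shift; rewrite subr0.
  have mu_le : `|mu| <= 2 * c.
    have : `|mu| ^+ 2 <= (2 * c) ^+ 2.
      rewrite real_normK ?num_real//.
      have : 0 <= mu ^+ 2 / r by rewrite divr_ge0 ?sqr_ge0// ltW.
      have := sqr_ge0 c; rewrite exprMn; lra.
    by rewrite ler_sqr ?nnegrE// mulr_ge0// ltW.
  have wmu : (y - mu) * mu / r <= c / r + c * (y - mu) ^+ 2 / r.
    rewrite -mulrDl ler_pM2r//; move: mu_le; rewrite ler_norml => /andP[m1 m2].
    have := sqr_ge0 (y - mu - 1); have := sqr_ge0 (y - mu + 1).
    move: c_gt0 m1 m2; nra.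
  have -> : y ^+ 2 / (2 * r) = (y - mu) ^+ 2 / (2 * r) + (y - mu) * mu / r
      + mu ^+ 2 / (2 * r) by field; rewrite gt_eqF.
  have := bound_small _ _ _ _ _ z0 w0 wmu mu2; rewrite -/B0 -/B1; lra.
apply: (@le_trans _ _ (E * (slab_odds x * phi r x y))); last first.
  by apply: ler_wpM2l; [exact: ltW|rewrite lerDr phi_ge0].
pose T := c ^+ 2 / (1 + r) + c + c * (x - mu) ^+ 2 / 2.
have c2r : 0 <= c ^+ 2 / (1 + r) by rewrite divr_ge0 ?sqr_ge0// addr_ge0// ltW.
have zc0 : 0 <= c * (x - mu) ^+ 2 by rewrite mulr_ge0// ltW.
have T0 : 0 <= T by rewrite /T; move: c_gt0; lra.
rewrite [leRHS]mulrCA.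
apply: (@le_trans _ _ (slab_odds x * (phi r mu y * expR (1 + T)))).
  rewrite mulrCA; apply: ler_wpM2l; first exact: phi_ge0.
  (* The odds factored out here cancel against the weight of the kept component. *)
  have -> : 1 + slab_odds x = slab_odds x * (1 + expR (kappa * (c ^+ 2 - x ^+ 2 / 2))).
    by rewrite mulrDr mulr1 /slab_odds -expRD addNr expR0 addrC.
  rewrite ler_pM2l//; apply: onepexp => //; apply: kappa_le => //.
  have lg : r / (1 + r) * c ^+ 2 <= mu ^+ 2 / 2.
    rewrite mulrAC ler_pdivrMr ?addr_gt0// mulrAC ler_pdivlMr//.
    by rewrite mulrC mulrA ltW.
  have c1 : 0 <= 1 - c^-1 by rewrite subr_ge0 invf_le1.
  have := ler_wpM2l c1 lg.
  have -> : (1 - c^-1) * (r / (1 + r) * c ^+ 2) =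
      c ^+ 2 - c ^+ 2 / (1 + r) - r / (1 + r) * c.
    have r1_gt0 : 0 < 1 + r by rewrite addr_gt0.
    by field; rewrite ?(gt_eqF r1_gt0) ?(gt_eqF c_gt0).
  have : r / (1 + r) * c <= c.
    by rewrite ler_piMl ?ltW// ltr_pdivrMr ?addr_gt0// mul1r ltrDr.
  (* The weight [c] in this square gives up a fraction [c^-1] of [mu ^+ 2], which costs at most [c],
     and leaves the squared noise with coefficient of order [c]. *)
  have : 0 <= (mu + c * (x - mu)) ^+ 2 / c by rewrite mulr_ge0 ?sqr_ge0// ltW.
  have -> : (mu + c * (x - mu)) ^+ 2 / c =
      mu ^+ 2 * c^-1 + 2 * (x - mu) * mu + c * (x - mu) ^+ 2.
    by field; rewrite gt_eqF.
  rewrite /T; lra.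
rewrite ler_pM2l//; apply: phi_shift.
have -> : (y - x) ^+ 2 / (2 * r) = (y - mu) ^+ 2 / (2 * r)
    - (x - mu) * (y - mu) / r + (x - mu) ^+ 2 / r / 2 by field; rewrite gt_eqF.
have : 0 <= (x - mu + (y - mu)) ^+ 2 / r by rewrite mulr_ge0 ?sqr_ge0// ltW.
have -> : (x - mu + (y - mu)) ^+ 2 / r = (x - mu) ^+ 2 / r
    + 2 * ((x - mu) * (y - mu) / r) + (y - mu) ^+ 2 / r by field; rewrite gt_eqF.
move=> /(bound_large _ _ _ (c ^+ 2 / (1 + r)) z0 w0).
rewrite /T -/B0 -/B1; lra.
Qed.

(** The mixture estimate pays the mean odds at every coordinate, and the quadratic bound at no more
    than [s] signals, whatever their size. *)
Lemma minimax_risk_sparse_box_le n s t :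
  (minimax_risk r (sparse_box n s t) <=
   (s%:R * (B0 + B1 * (8 + 8 * r)) + n%:R * (expR (1 - c ^+ 2) * c))%:E)%E.
Proof.
have B1_gt0 : 0 < B1 by rewrite mulr_gt0// !addr_gt0// divr_gt0.
have B0_gt0 : 0 < B0.
  by rewrite addr_gt0// ?divr_gt0 ?exprn_gt0// ?mulr_gt0 ?addr_gt0 ?invr_gt0.
have B01_ge0 : 0 <= B0 / B1 by rewrite divr_ge0 ?ltW.
apply: (@le_trans _ _ (max_risk r (sparse_box n s t) (@mixture_predictive n))).
  by apply: ereal_inf_lbound; exists (@mixture_predictive n) => //;
    exact: mixture_predictive_density.
apply: ge_ereal_sup => _ [theta [th_s _] <-].
(* Writing [B0] as [B1 * (B0 / B1)] puts the bound in the form that [integral_quadratic_phi]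
   integrates. *)
pose f (i : 'I_n) x y := if tnth theta i == 0 then slab_odds x else
  B1 * (B0 / B1 + (x - tnth theta i) ^+ 2 + (y - tnth theta i) ^+ 2).
pose F (i : 'I_n) x := if tnth theta i == 0 then slab_odds x else
  B1 * (B0 / B1 + 8 * r + (x - tnth theta i) ^+ 2).
pose S (i : 'I_n) := if tnth theta i == 0 then expR (1 - c ^+ 2) * c else
  B1 * (B0 / B1 + 8 * r + 8 * 1).
apply: (@le_trans _ _ (\sum_(i < n) S i)%:E).
  apply: (@risk_le R n r r_gt0 theta _ f F S) => [i x|i x y|i|i x|i x|i|x y].
  - rewrite /f; case: (tnth theta i == 0) => //.
    apply: measurable_funM => //; apply: measurable_funD => //.
    by apply: measurable_funX; exact: measurable_funB.
  - rewrite /f; case: (tnth theta i == 0); first exact: ltW.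
    apply: mulr_ge0; first exact: ltW.
    by rewrite !addr_ge0// sqr_ge0.
  - rewrite /F; case: (tnth theta i == 0) => //.
    apply: measurable_funM => //; apply: measurable_funD => //.
    by apply: measurable_funX; exact: measurable_funB.
  - rewrite /F; case: (tnth theta i == 0); first exact: ltW.
    apply: mulr_ge0; first exact: ltW.
    by rewrite !addr_ge0 ?sqr_ge0// mulr_ge0// ltW.
  - rewrite /f /F; case: eqP => _.
      under eq_integral do rewrite EFinM.
      rewrite ge0_integralZl//=.
      + by rewrite integral_phi// mule1.
      + by apply/measurable_EFinP; exact: measurable_phi.
      + by move=> y _; rewrite lee_fin phi_ge0.
      + by rewrite lee_fin ltW.
    rewrite addrAC; apply: integral_quadratic_phi => //; first exact: ltW.
    by rewrite addr_ge0// sqr_ge0.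
  - rewrite /F /S; case: eqP => [->|_]; first by rewrite integral_slab_odds.
    apply: integral_quadratic_phi => //; first exact: ltW.
    by rewrite addr_ge0// mulr_ge0// ltW.
  - rewrite lne_gauss_pdf_div// lee_fin; apply: ler_sum => i _.
    rewrite /f; case: eqP => [->|_]; first exact: log_ratio_mixture_null.
    apply: le_trans (log_ratio_mixture _ _ _) _.
    by rewrite -[in leRHS]addrA [leRHS]mulrDr [B1 * (B0 / B1)]mulrC divfK ?gt_eqF.
rewrite lee_fin.
apply: (@le_trans _ _ (\sum_(i < n) (expR (1 - c ^+ 2) * c +
   if tnth theta i != 0 then B0 + B1 * (8 + 8 * r) else 0))).
  apply: ler_sum => i _; rewrite /S; case: eqP => _ /=; first by rewrite addr0.
  rewrite -addrA mulrDr [B1 * (_ / _)]mulrC divfK ?gt_eqF//.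
  rewrite mulr1 [8 * r + 8]addrC lerDr mulr_ge0 ?expR_ge0// ltW//.
rewrite big_split/= sumr_const card_ord -big_mkcond/= sumr_const addrC.
rewrite -[X in X + _ <= _]mulr_natl -[X in _ + X <= _]mulr_natl lerD2r.
apply: ler_wpM2r; last by rewrite ler_nat.
apply: addr_ge0; first exact: ltW.
by apply: mulr_ge0; [exact: ltW|rewrite addr_ge0// mulr_ge0// ltW].
Qed.

End adaptive_mixture.

(** * Admissible signals and bounds on the joint density *)

Lemma first_coords_sparse_box (R : realType) n s (mu t : R) :
  (s <= n)%N -> 0 <= mu <= t -> sparse_box n s t (first_coords R n s mu).
Proof.
move=> sn /andP[mu0 mut]; split=> [|i]; last first.
  rewrite tnth_mktuple; case: ifP => _; first by rewrite ger0_norm.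
  by rewrite normr0 (le_trans mu0).
apply: (@leq_trans #|[pred i : 'I_n | (i < s)%N]|).
  apply: subset_leq_card; apply/fintype.subsetP => i; rewrite !inE tnth_mktuple.
  by case: ifP => // _; rewrite eqxx.
by rewrite -sum1_card -(big_ord_widen n (fun=> 1%N))// sum1_card card_ord.
Qed.

(** Expresses the density under another mean through the true one, with the noise [x - m]
    explicit. *)
Lemma phi_recenter (R : realType) (v m m' x : R) : 0 < v ->
  phi v m' x = phi v m x *
    expR (- ((m - m') * (x - m) / v + (m - m') ^+ 2 / (2 * v))).
Proof.
move=> v0; rewrite !phiE// -mulrA -expRD; congr (_ * expR _).
by field; rewrite gt_eqF.
Qed.

Section joint_density_bounds.
Context (R : realType) (r : R) (eta : {i01 R}) (l : {posnum R}).
Hypothesis r_gt0 : 0 < r.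
Local Notation P := (spike_slab eta l).

Let rV_gt0 : 0 < r^-1. Proof. by rewrite invr_gt0. Qed.

(* [u] is a displacement of the mean, [z] and [w] are the noises of [x] and [y]. *)
Let cross_term_le (b u z w : R) : `|u| <= b ->
  - (u * z) - u * w / r <= b * (1 + r^-1) / 2 * (1 + (z ^+ 2 + w ^+ 2)).
Proof.
rewrite ler_norml => /andP[u1 u2].
have b0 : 0 <= b by lra.
have side a : - (u * a) <= b / 2 * (1 + a ^+ 2).
  have : 0 <= (b + u) * (1 + a) ^+ 2 by rewrite mulr_ge0 ?sqr_ge0//; lra.
  have : 0 <= (b - u) * (1 - a) ^+ 2 by rewrite mulr_ge0 ?sqr_ge0//; lra.
  lra.
have sz := side z.
have sw : - (u * w) / r <= b / 2 * (1 + w ^+ 2) / r by rewrite ler_pM2r//; exact: side.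
have : 0 <= b * w ^+ 2 by rewrite mulr_ge0// sqr_ge0.
have : 0 <= b * z ^+ 2 * r^-1.
  by apply: mulr_ge0; [apply: mulr_ge0 => //; exact: sqr_ge0|exact: ltW].
have -> : b * (1 + r^-1) / 2 * (1 + (z ^+ 2 + w ^+ 2)) =
  b / 2 * (1 + z ^+ 2) + b / 2 * (1 + w ^+ 2) / r + b * w ^+ 2 / 2
   + b * z ^+ 2 * r^-1 / 2 by field; rewrite gt_eqF.
move: sz sw; rewrite !mulNr; lra.
Qed.

(** [M] is the exponent lost by moving both means from [mu] to 0, so the spike contributes
    [expR (- M)]; by hypothesis so does the slab, up to [D]. In [A], the part [q * mu] covers the
    cross terms, and [q] the Gaussian factors absent from the slab bound. *)
Lemma joint_le_wide_slab (mu D : R) (q := (1 + r^-1) / 2) (A := q * (mu + 1))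
    (M := mu ^+ 2 * q) : 0 <= mu -> 0 < D ->
  eta%:num / (2 * l%:num) <= D * expR (- M) ->
  forall x y, joint P r x y <= phi 1 mu x * phi r mu y *
   expR (- (M - A - ln (1 + D / peak 1)) + A * ((x - mu) ^+ 2 + (y - mu) ^+ 2)).
Proof.
move=> mu0 D0 etaD x y.
have pk1 : 0 < peak (1 : R) by exact: peak_gt0.
have pkr : 0 < peak r by exact: peak_gt0.
have q0 : 0 < q by rewrite /q divr_gt0// addr_gt0.
apply: le_trans (joint_spike_slab_le _ _ _ _ _ _ r_gt0) _.
set z := x - mu; set w := y - mu; set W := phi 1 mu x * phi r mu y.
have W0 : 0 < W by rewrite mulr_gt0// phi_gt0.
pose E := expR (- M + A + A * (z ^+ 2 + w ^+ 2)).
have -> : expR (- (M - A - ln (1 + D / peak 1)) + A * (z ^+ 2 + w ^+ 2)) =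
    (1 + D / peak 1) * E.
  rewrite -[X in X * E]lnK ?posrE ?addr_gt0 ?divr_gt0// /E -expRD.
  by congr expR; ring.
rewrite mulrA mulrDr mulr1 mulrDl; apply: lerD.
  rewrite (phi_recenter _ 1 mu 0 x)// (phi_recenter _ r mu 0 y)//.
  rewrite mulrACA -expRD; apply: ler_wpM2l; first exact: ltW.
  rewrite ler_expR subr0 -/z -/w.
  have := cross_term_le mu mu z w; rewrite ger0_norm// => /(_ (lexx _)).
  have : 0 <= q * (1 + (z ^+ 2 + w ^+ 2)).
    by rewrite mulr_ge0 ?addr_ge0 ?sqr_ge0// ltW.
  rewrite /A /M.
  have -> : mu ^+ 2 / (2 * r) = mu ^+ 2 * q - mu ^+ 2 / 2.
    by rewrite /q; field; rewrite gt_eqF.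
  have -> : mu * (1 + r^-1) / 2 = mu * q by rewrite /q mulrA.
  rewrite !mulr1 !divr1; move: (mu * w / r) => mwr.
  lra.
(* The slab bound is constant in x and y: the decay of [W] is undone by the noise term, as [q] is at
   least both [1 / 2] and [1 / (2 * r)]. *)
apply: (@le_trans _ _ (D * expR (- M) * peak r)).
  by apply: ler_wpM2r; [exact: ltW|].
rewrite /W !phiE// -/z -/w /E.
have -> : - M + A + A * (z ^+ 2 + w ^+ 2) = - M + (A * (1 + (z ^+ 2 + w ^+ 2))).
  by ring.
rewrite expRD mulr1.
set e1 := expR (- (z ^+ 2 / 2)); set e2 := expR (- (w ^+ 2 / (2 * r))).
rewrite [leRHS](_ : _ = D * expR (- M) * peak r *
   (e1 * e2 * expR (A * (1 + (z ^+ 2 + w ^+ 2))))); last by field; rewrite gt_eqF.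
have DM0 : 0 <= D * expR (- M) * peak r by rewrite !mulr_ge0 ?expR_ge0// ltW.
apply: ler_peMr => //.
rewrite /e1 /e2 -!expRD -[leLHS]expR0 ler_expR.
have : 0 <= mu * q * (1 + (z ^+ 2 + w ^+ 2)).
  by rewrite !mulr_ge0 ?addr_ge0 ?sqr_ge0// ltW.
have : 0 <= z ^+ 2 / r by rewrite divr_ge0 ?sqr_ge0// ltW.
have -> : w ^+ 2 / (2 * r) = w ^+ 2 * q - w ^+ 2 / 2.
  by rewrite /q; field; rewrite gt_eqF.
have := sqr_ge0 z; have := sqr_ge0 w.
rewrite /A; have : q * z ^+ 2 = z ^+ 2 / 2 + z ^+ 2 / r / 2.
  by rewrite /q; field; rewrite gt_eqF.
move: q0; lra.
Qed.

(** Every mean charged by the prior lies at distance between [(1 - d) * t] and [2 * t] from [t]. The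
    lower bound yields the gain, the upper one controls the cross terms. *)
Lemma joint_le_narrow_slab (t d : R) (q := (1 + r^-1) / 2) (A := 2 * t * q) :
  0 <= t -> 0 <= d <= 1 -> l%:num <= d * t ->
  forall x y, joint P r x y <= phi 1 t x * phi r t y *
   expR (- ((1 - d) ^+ 2 * t ^+ 2 * q - A) + A * ((x - t) ^+ 2 + (y - t) ^+ 2)).
Proof.
move=> t0 /andP[d0 d1] lt x y.
have q0 : 0 < q by rewrite /q divr_gt0// addr_gt0.
apply: joint_spike_slab_sup => // m ml.
rewrite (phi_recenter _ 1 t m x)// (phi_recenter _ r t m y)//.
rewrite mulrACA -expRD; apply: ler_wpM2l; first by rewrite mulr_ge0 ?phi_ge0.
rewrite ler_expR; set z := x - t; set w := y - t; set u := t - m.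
have dt : d * t <= t by rewrite ler_piMl.
have := le_trans ml lt; rewrite ler_norml => /andP[m1 m2].
have u1 : (1 - d) * t <= u by rewrite /u; lra.
have u2 : `|u| <= 2 * t by rewrite ler_norml /u; lra.
have := cross_term_le (2 * t) u z w u2.
have -> : 2 * t * (1 + r^-1) / 2 = A by rewrite /A /q mulrA.
have : (1 - d) ^+ 2 * t ^+ 2 * q <= u ^+ 2 * q.
  rewrite ler_pM2r// -exprMn ler_sqr ?nnegrE//.
    by rewrite mulr_ge0// subr_ge0.
  by apply: le_trans u1; rewrite mulr_ge0// subr_ge0.
have -> : u ^+ 2 / (2 * r) = u ^+ 2 * q - u ^+ 2 / 2.
  by rewrite /q; field; rewrite gt_eqF.
rewrite !mulr1 !divr1; move: (u * w / r) => uwr; lra.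
Qed.

End joint_density_bounds.

(** * Risk of the spike-and-slab estimate *)

(** For such [e], [(1 - e)^-1 <= 1 + 2 * e <= expR (2 * e)]. *)
Lemma ln_1B_ge (R : realType) (e : R) : 0 <= e <= 1 / 2 -> - (2 * e) <= ln (1 - e).
Proof.
move=> /andP[e0 e2]; have e1 : 0 < 1 - e by lra.
rewrite -ler_expR lnK ?posrE// expRN invf_ple ?posrE ?expR_gt0//.
apply: le_trans (expR_ge1Dx _).
rewrite -[leLHS]mul1r ler_pdivrMr//; nra.
Qed.

Section spike_slab_max_risk.
Context (R : realType) (r beta : R).
Hypothesis r_gt0 : 0 < r.
Hypothesis beta_gt0 : 0 < beta.

Let q := (1 + r^-1) / 2.

(* The worst signal [wide_signal * sqrt (ln (1 / eta))] for a wide slab: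
   it makes [mu ^+ 2 * (1 + r^-1) / 2] equal to [ln (t / eta)]. *)
Definition wide_signal := Num.sqrt ((1 + beta) / q).

Let m := wide_signal.

Let q_gt0 : 0 < q.
Proof. by rewrite /q divr_gt0// addr_gt0// invr_gt0. Qed.

Let m_ge0 : 0 <= m. Proof. exact: sqrtr_ge0. Qed.

Let m2q : m ^+ 2 * q = 1 + beta.
Proof.
rewrite sqr_sqrtr; last by rewrite divr_ge0// ltW// addr_gt0.
by rewrite divfK// gt_eqF.
Qed.

(** Coefficient of [c] in the losses of [spike_slab_risk_ge] at the signal [m * c], with
    [D = 2 * (1 + r)] in [joint_le_wide_slab]; the final 2 pays for [n * ln (1 - e)], shared among
    the [s] signals. *)
Definition wide_loss : R :=
  q * (m + 1) + ln (1 + 2 * (1 + r) / peak 1) + (m + 1) / 2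
  + (q * (m + 1) + (m + 1) / 2) * (8 + 8 * r) + 2.

Let lnD : 0 <= ln (1 + 2 * (1 + r) / peak 1).
Proof.
apply: ln_ge0; rewrite lerDl divr_ge0 ?normal_peak_ge0//.
by rewrite mulr_ge0// addr_ge0// ltW.
Qed.

Lemma wide_loss_ge0 : 0 <= wide_loss.
Proof.
have m1 : 0 <= m + 1 by rewrite addr_ge0.
have qm1 : 0 <= q * (m + 1) by rewrite mulr_ge0// ltW.
have r8 : 0 <= 8 + 8 * r by move: r_gt0; lra.
have qm8 : 0 <= (q * (m + 1) + (m + 1) / 2) * (8 + 8 * r).
  by rewrite mulr_ge0// addr_ge0// divr_ge0.
rewrite /wide_loss; move: lnD m1 qm1 qm8; lra.
Qed.

(** Coefficient of [t] in the losses at the signal [t], where [A = 2 * t * q]: [A + t / 2] occurs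
    once directly and [8 + 8 * r] times through the noise. *)
Definition narrow_loss : R := (2 * q + 1 / 2) * (9 + 8 * r).

Context (n s : nat) (eta : {i01 R}) (t c : R).
Let e := eta%:num.
Hypothesis sn : (s <= n)%N.
Hypothesis neE : n%:R * e = s%:R.
Hypothesis e_le : e <= 1 / 2.
Hypothesis eE : e = expR (- c ^+ 2).
Hypothesis tE : t = expR (beta * c ^+ 2).
Hypothesis c_ge1 : 1 <= c.
Hypothesis mt : m * c <= t.
Hypothesis narrow : (1 + beta) * c ^+ 2 / (1 + r) <=
  t ^+ 2 / (4 * r) - narrow_loss * t - 2.

Let e_lt1 : e < 1. Proof. by move: e_le; lra. Qed.

Let e_ge0 : 0 <= e. Proof. by rewrite /e. Qed.

Let t_gt0 : 0 < t. Proof. by rewrite tE expR_gt0. Qed.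

Let n_ln : - (2 * s%:R) <= n%:R * ln (1 - e).
Proof.
rewrite -neE mulrCA -mulrN; apply: ler_wpM2l; first exact: ler0n.
by apply: ln_1B_ge; rewrite e_ge0.
Qed.

Lemma spike_slab_max_risk_ge (l : {posnum R}) :
  ((s%:R * ((1 + beta) * c ^+ 2 / (1 + r) - wide_loss * c))%:E <=
   max_risk r (sparse_box n s t) (spike_slab_predictive n r eta l))%E.
Proof.
have r1_gt0 : 0 < 1 + r by rewrite addr_gt0.
have D0 : 0 < 2 * (1 + r) by rewrite mulr_gt0.
have [wide|narrow_l] := leP (t / (4 * (1 + r))) l%:num.
  pose mu := m * c.
  have mu0 : 0 <= mu by rewrite mulr_ge0//; move: c_ge1; lra.
  have mu2q : mu ^+ 2 * q = (1 + beta) * c ^+ 2 by rewrite exprMn mulrAC m2q.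
  (* The slab density is at most [2 * (1 + r) * e / t], and
     [e / t = expR (- ((1 + beta) * c ^+ 2))]. *)
  have eta_l : eta%:num / (2 * l%:num) <= 2 * (1 + r) * expR (- (mu ^+ 2 * q)).
    rewrite mu2q.
    have -> : - ((1 + beta) * c ^+ 2) = - c ^+ 2 + - (beta * c ^+ 2) by ring.
    rewrite expRD -eE [expR (- (beta * _))]expRN -tE.
    rewrite mulrCA -/e; apply: ler_wpM2l => //.
    have -> : 2 * (1 + r) / t = (2 * (t / (4 * (1 + r))))^-1.
      by field; rewrite !gt_eqF.
    have tl : 2 * (t / (4 * (1 + r))) <= 2 * l%:num by rewrite ler_pM2l.
    have tl0 : 0 < 2 * (t / (4 * (1 + r))) by rewrite mulr_gt0// divr_gt0// mulr_gt0.
    by rewrite lef_pV2 ?posrE// (lt_le_trans tl0).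
  have := joint_le_wide_slab _ _ _ _ r_gt0 _ _ mu0 D0 eta_l.
  set A := (1 + r^-1) / 2 * (mu + 1) => jle.
  have A0 : 0 <= A by rewrite mulr_ge0 ?(ltW q_gt0)// addr_ge0.
  have := spike_slab_risk_ge _ _ _ _ _ _ _ _ _ e_lt1 r_gt0 sn mu0 A0 jle.
  rewrite -/q -/e mu2q => rge.
  apply: (@le_trans _ _ (risk r (first_coords R n s mu)
    (spike_slab_predictive n r eta l))); last first.
    apply: ereal_sup_ubound; exists (first_coords R n s mu) => //.
    by apply: first_coords_sparse_box => //; rewrite mu0.
  apply: le_trans rge; rewrite lee_fin.
  have mu1 : mu + 1 <= (m + 1) * c by rewrite /mu mulrDl mul1r lerD2l.
  have Ale : A <= q * (m + 1) * c by rewrite /A -/q -mulrA ler_pM2l.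
  have mu2 : mu ^+ 2 / 2 = (1 + beta) * c ^+ 2 - (1 + beta) * c ^+ 2 / (1 + r).
    by rewrite -mu2q /q; field; rewrite !gt_eqF.
  rewrite mu2.
  have r8 : 0 <= 8 + 8 * r by move: r_gt0; lra.
  have := ler_wpM2r r8 (lerD Ale (_ : mu / 2 <= (m + 1) * c / 2)).
  have mu3 : mu / 2 <= (m + 1) * c / 2 by move: mu1; lra.
  move=> /(_ mu3) Ale8.
  have lnc : ln (1 + 2 * (1 + r) / peak 1) <= ln (1 + 2 * (1 + r) / peak 1) * c.
    by rewrite ler_peMr.
  apply: (@le_trans _ _ (s%:R * ((1 + beta) * c ^+ 2 / (1 + r) - wide_loss * c + 2)
     - 2 * s%:R)); first by rewrite mulrDr; lra.
  apply: lerD => //; apply: ler_wpM2l; first exact: ler0n.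
  rewrite /wide_loss; move: lnc Ale8 Ale mu3 c_ge1.
  set Z := ln _; set W := q * (m + 1); lra.
have t0 : 0 <= t by exact: ltW.
(* This value makes [(1 - 2 * d) * q = 1 / 2 + 1 / (4 * r)], whence the gain [t ^+ 2 / (4 * r)]
   below. *)
pose d := (4 * (1 + r))^-1.
have d0 : 0 < d by rewrite invr_gt0 mulr_gt0.
have d1 : d <= 1 by rewrite invf_le1 ?mulr_gt0//; move: r_gt0; lra.
have ld : l%:num <= d * t by rewrite /d mulrC ltW.
have d01 : 0 <= d <= 1 by rewrite (ltW d0).
have := joint_le_narrow_slab _ _ eta l r_gt0 _ _ t0 d01 ld.
rewrite -/q => jle.
have A0 : 0 <= 2 * t * q by apply: mulr_ge0; [exact: mulr_ge0|exact: ltW].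
have := spike_slab_risk_ge _ _ _ _ _ _ _ _ _ e_lt1 r_gt0 sn t0 A0 jle.
rewrite -/e => rge.
apply: (@le_trans _ _ (risk r (first_coords R n s t)
  (spike_slab_predictive n r eta l))); last first.
  apply: ereal_sup_ubound; exists (first_coords R n s t) => //.
  by apply: first_coords_sparse_box => //; rewrite t0 lexx.
apply: le_trans rge; rewrite lee_fin.
have gain : t ^+ 2 / (4 * r) <= (1 - d) ^+ 2 * t ^+ 2 * q - t ^+ 2 / 2.
  have -> : t ^+ 2 / (4 * r) = (1 - 2 * d) * q * t ^+ 2 - t ^+ 2 / 2.
    by rewrite /d /q; field; rewrite !gt_eqF.
  rewrite lerD2r mulrAC; apply: ler_wpM2r; first exact: ltW.
  apply: ler_wpM2r; first exact: sqr_ge0.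
  by have := sqr_ge0 d; lra.
have loss0 : 0 <= wide_loss * c.
  by rewrite mulr_ge0 ?wide_loss_ge0//; move: c_ge1; lra.
apply: (@le_trans _ _ (s%:R * (t ^+ 2 / (4 * r) - narrow_loss * t)
   - 2 * s%:R)).
  rewrite -subr_ge0.
  rewrite (_ : _ - _ = s%:R * (t ^+ 2 / (4 * r) - narrow_loss * t - 2
    - ((1 + beta) * c ^+ 2 / (1 + r) - wide_loss * c))); last by ring.
  by rewrite mulr_ge0//; move: narrow loss0; lra.
apply: lerD => //; apply: ler_wpM2l; first exact: ler0n.
rewrite /narrow_loss; move: gain; lra.
Qed.

End spike_slab_max_risk.

(** * Comparison of the two risk bounds *)

Definition minimax_slack (R : realType) (r : R) : R :=
  2 + r^-1 + (2 + r + 2 / r) * (8 + 8 * r) + expR 1.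

Lemma minimax_risk_le (R : realType) (r c : R) (n s : nat) (t : R) :
  0 < r -> 1 <= c -> n%:R * expR (- c ^+ 2) = s%:R ->
  (minimax_risk r (sparse_box n s t) <=
   (s%:R * (c ^+ 2 / (1 + r) + minimax_slack R r * c))%:E)%E.
Proof.
move=> r0 c1 nE; apply: le_trans (minimax_risk_sparse_box_le R r c r0 c1 n s t) _.
rewrite lee_fin expRD [n%:R * _]mulrA [n%:R * (expR 1 * _)]mulrCA nE.
by rewrite le_eqVlt; apply/orP; left; apply/eqP; rewrite /minimax_slack; ring.
Qed.

(** Since [c ^+ 2 <= t / beta] and [1 <= t], every other term is at most linear in [t], and
    [t ^+ 2 / (4 * r)] dominates them once [t] is large. *)
Lemma narrow_gain (R : realType) (r beta b c t : R) :
  0 < r -> 0 < beta -> 0 <= c -> 1 + beta * c ^+ 2 <= t ->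
  4 * r * (b + 2 + (1 + beta) / beta) <= t ->
  (1 + beta) * c ^+ 2 / (1 + r) <= t ^+ 2 / (4 * r) - b * t - 2.
Proof.
move=> r0 beta0 c0 ct Tt.
have bc : 0 <= beta * c ^+ 2 by rewrite mulr_ge0 ?sqr_ge0// ltW.
have t1 : 1 <= t by lra.
have h1 : (b + 2 + (1 + beta) / beta) * t <= t ^+ 2 / (4 * r).
  rewrite expr2 mulrAC ler_pM2r; last by lra.
  by rewrite ler_pdivlMr ?mulr_gt0// mulrC.
have h2 : (1 + beta) * c ^+ 2 <= (1 + beta) / beta * t.
  have -> : (1 + beta) * c ^+ 2 = (1 + beta) / beta * (beta * c ^+ 2).
    by field; rewrite gt_eqF.
  by rewrite ler_pM2l ?divr_gt0 ?addr_gt0//; lra.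
have h3 : (1 + beta) * c ^+ 2 / (1 + r) <= (1 + beta) * c ^+ 2.
  rewrite ler_pdivrMr ?addr_gt0//; apply: ler_peMr; last by rewrite lerDl ltW.
  by rewrite mulr_ge0 ?sqr_ge0// ltW// addr_gt0.
lra.
Qed.

(** The leading terms of the two bounds have ratio exactly [1 + beta]; the remainders are smaller by
    a factor of order [1 / c n], which gives one explicit [eps] for all [l]. *)
Theorem theorem1p5 (R : realType) (r beta : R)
    (s : nat -> nat) (eta : nat -> {i01 R}) (t : nat -> R)
    (r_gt0 : 0 < r) (beta_gt0 : 0 < beta)
    (s_bounds : forall n, (0 < n)%N -> (1 <= s n <= n)%N)
    (etaE : forall n, (0 < n)%N -> (eta n)%:num = (s n)%:R / n%:R)
    (eta_cvg0 : (eta n)%:num @[n --> \oo] --> (0 : R))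
    (t_gt0 : forall n, (0 < n)%N -> 0 < t n)
    (ln_tE : forall n, (0 < n)%N -> ln (t n) = beta * ln ((eta n)%:num^-1)) :
  exists2 eps : nat -> R, eps n @[n --> \oo] --> (0 : R) &
    \forall n \near \oo,
      ((1 + beta)%:E * minimax_risk r (sparse_box n (s n) (t n))
         * (1 + eps n)%:E
       <= ereal_inf [set max_risk r (sparse_box n (s n) (t n))
                                    (spike_slab_predictive n r (eta n) l)
                    | l in [set l : {posnum R} | 1 < l%:num]%R])%E.
Proof.
pose c n := Num.sqrt (ln ((eta n)%:num^-1)).
(* As [eta n] tends to 0, [c n] eventually exceeds any constant; all thresholds below are met this
   way. *)
have c_large (K : R) : \forall n \near \oo, (0 < n)%N /\ K <= c n.
  near=> n.
  have n0 : (0 < n)%N by near: n; exists 1%N.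
  split => //.
  have /andP[s1 _] := s_bounds n n0.
  have eta0 : 0 < (eta n)%:num by rewrite etaE// divr_gt0// ltr0n.
  have etaK : (eta n)%:num < expR (- K ^+ 2).
    by near: n; apply: (cvgr_lt 0) => //; rewrite expR_gt0.
  apply: le_trans (ler_norm K) _; rewrite -sqrtr_sqr ler_wsqrtr//.
  rewrite -ler_expR lnK ?posrE ?invr_gt0//.
  by rewrite -[leLHS]invrK -expRN lef_pV2 ?posrE ?expR_gt0// ltW.
have beta1_gt0 : 0 < 1 + beta by rewrite addr_gt0.
have r1_gt0 : 0 < 1 + r by rewrite addr_gt0.
pose W := wide_loss R r beta.
(* Chosen so that [C * c n / (1 + r)] absorbs the terms linear in [c n] of both bounds. *)
pose C := (1 + r) * (minimax_slack R r + W / (1 + beta)).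
exists (fun n => - (C / c n)).
  apply/cvgr0Pnorm_lt => e e0; near=> n.
  have [n0 cn] : (0 < n)%N /\ `|C| / e + 1 <= c n by near: n; exact: c_large.
  have Ce0 : 0 <= `|C| / e by rewrite divr_ge0// ltW.
  have c0 : 0 < c n by apply: lt_le_trans cn; rewrite ltr_wpDl.
  rewrite normrN normrM normfV (gtr0_norm c0) ltr_pdivrMr// mulrC.
  by rewrite -ltr_pdivrMr//; apply: lt_le_trans cn; rewrite ltrDl.
pose T := 4 * r * (narrow_loss R r + 2 + (1 + beta) / beta).
pose m := wide_signal R r beta.
near=> n.
have [n0 c1] : (0 < n)%N /\ 1 <= c n by near: n; exact: c_large.
(* This makes [1 + eps n] nonnegative, so that the minimax upper bound may be multiplied by it. *)
have [_ cC] : (0 < n)%N /\ C <= c n by near: n; exact: c_large.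
have [_ cT] : (0 < n)%N /\ T / beta <= c n by near: n; exact: c_large.
have [_ cm] : (0 < n)%N /\ m / beta <= c n by near: n; exact: c_large.
have c0 : 0 < c n by exact: lt_le_trans c1.
have /andP[s1 sn] := s_bounds n n0.
have eta0 : 0 < (eta n)%:num by rewrite etaE// divr_gt0// ltr0n.
(* [Num.sqrt] vanishes on negative numbers, so [0 < c n] excludes a negative logarithm. *)
have c2E : c n ^+ 2 = ln ((eta n)%:num^-1).
  rewrite sqr_sqrtr//; have [//|lt0] := leP 0 (ln (eta n)%:num^-1).
  by move: c0; rewrite /c ler0_sqrtr ?ltxx// ltW.
have eE : (eta n)%:num = expR (- c n ^+ 2).
  by rewrite c2E expRN lnK ?invrK// posrE invr_gt0.
have tE : t n = expR (beta * c n ^+ 2) by rewrite c2E -ln_tE// lnK// posrE t_gt0.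
have neE : n%:R * (eta n)%:num = (s n)%:R.
  by rewrite etaE// mulrCA divff ?mulr1// pnatr_eq0 -lt0n.
have c2_ge : c n <= c n ^+ 2 by rewrite expr2 ler_peMl// ltW.
have e_le : (eta n)%:num <= 1 / 2.
  rewrite eE expRN div1r lef_pV2 ?posrE ?expR_gt0//.
  by apply: le_trans (expR_ge1Dx _); rewrite -[2%:R]/(1 + 1) lerD2l (le_trans c1).
have t_ge : 1 + beta * c n ^+ 2 <= t n by rewrite tE expR_ge1Dx.
(* Here [t n] is at least [beta * c n ^+ 2], hence at least [beta * c n]. *)
have bc_ge K : K / beta <= c n -> K <= t n.
  rewrite ler_pdivrMr// mulrC => Kc; apply: le_trans Kc _.
  apply: le_trans t_ge; apply: ler_wpDl => //.
  by rewrite ler_pM2l.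
have mt : m * c n <= t n.
  apply: le_trans t_ge; apply: ler_wpDl => //.
  rewrite expr2 mulrA ler_pM2r//; move: cm; rewrite ler_pdivrMr// mulrC.
  by [].
have narrow := narrow_gain R r beta (narrow_loss R r) (c n) (t n) r_gt0 beta_gt0
  (ltW c0) t_ge (bc_ge _ cT).
apply: le_ereal_inf_tmp => _ [l _ <-].
apply: le_trans (spike_slab_max_risk_ge R r beta r_gt0 beta_gt0 n (s n) (eta n)
  (t n) (c n) sn neE e_le eE tE c1 mt narrow l).
have nE : n%:R * expR (- c n ^+ 2) = (s n)%:R by rewrite -eE.
have eps_ge0 : 0 <= 1 + - (C / c n) by rewrite subr_ge0 ler_pdivrMr// mul1r.
apply: (@le_trans _ _ ((1 + beta)%:E *
    ((s n)%:R * (c n ^+ 2 / (1 + r) + minimax_slack R r * c n))%:E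
    * (1 + - (C / c n))%:E)%E).
  apply: lee_wpmul2r; first by rewrite lee_fin.
  apply: lee_wpmul2l; first by rewrite lee_fin ltW.
  exact: minimax_risk_le.
rewrite -!EFinM lee_fin.
have -> : (1 + beta) * ((s n)%:R * (c n ^+ 2 / (1 + r) + minimax_slack R r * c n))
    * (1 + - (C / c n)) = (s n)%:R * ((1 + beta) *
    (c n ^+ 2 / (1 + r) + minimax_slack R r * c n - C * c n / (1 + r)
     - minimax_slack R r * C)).
  by field; rewrite !gt_eqF.
apply: ler_wpM2l; first exact: ler0n.
have -> : C * c n / (1 + r) = minimax_slack R r * c n + W * c n / (1 + beta).
  by rewrite /C; field; rewrite !gt_eqF.
have slack0 : 0 <= minimax_slack R r.
  have r8 : 0 <= 8 + 8 * r by rewrite addr_ge0// mulr_ge0// ltW.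
  have rV : 0 <= r^-1 by rewrite invr_ge0 ltW.
  have r2 : 0 <= 2 + r + 2 / r by rewrite !addr_ge0// ?mulr_ge0// ltW.
  by rewrite /minimax_slack addr_ge0 ?expR_ge0// addr_ge0// ?mulr_ge0// addr_ge0.
have W0 : 0 <= W by exact: wide_loss_ge0.
have C0 : 0 <= C.
  apply: mulr_ge0; first exact: ltW.
  by apply: addr_ge0 => //; rewrite divr_ge0// ltW.
have SC0 : 0 <= (1 + beta) * (minimax_slack R r * C).
  by apply: mulr_ge0; [exact: ltW|exact: mulr_ge0].
(* The slack cancels, and what is left is the lower bound minus a nonnegative constant. *)
have -> : (1 + beta) * (c n ^+ 2 / (1 + r) + minimax_slack R r * c n
    - (minimax_slack R r * c n + W * c n / (1 + beta)) - minimax_slack R r * C)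
  = (1 + beta) * c n ^+ 2 / (1 + r) - W * c n - (1 + beta) * (minimax_slack R r * C).
  by field; rewrite !gt_eqF.
by rewrite gerBl.
Unshelve. all: by end_near. Qed.
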